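(* There exists an integer $n_0$ such that for every $n>n_0$, if $G$ minimizes $t(G)+i(G)$ among all $n$-vertex oriented graphs, then $G\in\mathcal E_n$.
   Context: An oriented graph is a directed graph with no loops and no multiple (parallel or anti-parallel) edges. For an oriented graph $G$, $t(G)$ (resp. $i(G)$) is the probability that a uniformly random $3$-set of vertices induces a transitive triangle (resp. an independent set). $\mathcal B_n=(V,E)$ is the oriented graph whose vertex set $V$ is the disjoint union of $V_0,V_1,V_2$ with $|V_i|=\lfloor (n+i)/3\rfloor$, and whose edge set consists of all directed edges from $V_i$ to $V_{i+1\bmod 3}$, $0\le i\le 2$. $\mathcal M_n$ is the family of all triangle-free $n$-vertex oriented graphs on the vertex set $V$ which are the union of three matchings: one between $V_0$ and $V_1$, one between $V_1$ and $V_2$, and one between $V_2$ and $V_0$. $\mathcal E_n=\{\mathcal B_n\setminus H : H\in\mathcal M_n\}$, where $\mathcal B_n\setminus H$ is obtained from $\mathcal B_n$ by deleting the edges of $H$. *)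

(* Defs.v *)
From HB Require Import structures.
From mathcomp Require Import all_boot all_order all_algebra.

Set Implicit Arguments.
Unset Strict Implicit.
Unset Printing Implicit Defensive.

Import Order.TTheory GRing.Theory Num.Theory.

Record ograph (T : finType) := OGraph {
  arc :> rel T;
  arc_irrefl : irreflexive arc;
  arc_antisym : forall x y, arc x y -> ~~ arc y x
}.

Definition adjacent (T : finType) (G : ograph T) (x y : T) : bool :=
  G x y || G y x.

Definition isomorphic (T U : finType) (G : ograph T) (H : ograph U) : Prop :=
  exists f : T -> U, bijective f /\ forall x y, H (f x) (f y) = G x y.

Definition prob3 (T : finType) (P : pred {set T}) : rat :=
  (#|[set A : {set T} | #|A| == 3 & P A]|%:R
     / #|[set A : {set T} | #|A| == 3]|%:R)%R.

(* For a 3-set A, the vertices x, y, z are automatically distinct, so they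
   exhaust A. *)
Definition transitive_triangle (T : finType) (G : ograph T) (A : {set T}) :=
  [exists x in A, exists y in A, exists z in A, [&& G x y, G y z & G x z]].

Definition independent (T : finType) (G : ograph T) (A : {set T}) :=
  [forall x in A, forall y in A, ~~ G x y].

Definition t_density (T : finType) (G : ograph T) : rat :=
  prob3 (transitive_triangle G).

Definition i_density (T : finType) (G : ograph T) : rat :=
  prob3 (independent G).

Definition minimizes_ti (T : finType) (G : ograph T) : Prop :=
  forall (U : finType) (G' : ograph U), #|U| = #|T| ->
    (t_density G + i_density G <= t_density G' + i_density G')%R.

Definition vertex (n : nat) : finType := {i : 'I_3 & 'I_((n + i) %/ 3)}.

Definition part (n : nat) (i : 'I_3) : {set vertex n} :=
  [set v : vertex n | tag v == i].

(* [ordS] is the cyclic successor, here i |-> i + 1 mod 3. *)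
Definition B_arc (n : nat) : rel (vertex n) :=
  fun u v => tag v == ordS (tag u).

Lemma B_arc_irrefl n : irreflexive (@B_arc n).
Proof. by move=> u; rewrite /B_arc; case: (tag u) => [[|[|[]]]]. Qed.

Lemma B_arc_antisym n x y : @B_arc n x y -> ~~ B_arc y x.
Proof.
rewrite /B_arc => /eqP ->.
by case: (tag x) => [[|[|[]]]].
Qed.

Definition B_graph (n : nat) : ograph (vertex n) :=
  OGraph (@B_arc_irrefl n) (@B_arc_antisym n).

Definition del_arc (T : finType) (G H : ograph T) : rel T :=
  fun x y => G x y && ~~ H x y.

Lemma del_arc_irrefl (T : finType) (G H : ograph T) : irreflexive (del_arc G H).
Proof. by move=> x; rewrite /del_arc arc_irrefl. Qed.

Lemma del_arc_antisym (T : finType) (G H : ograph T) x y :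
  del_arc G H x y -> ~~ del_arc G H y x.
Proof. by case/andP=> /arc_antisym /negbTE Gyx _; rewrite /del_arc Gyx. Qed.

Definition delete (T : finType) (G H : ograph T) : ograph T :=
  OGraph (@del_arc_irrefl T G H) (@del_arc_antisym T G H).

Definition triangle_free (T : finType) (G : ograph T) : Prop :=
  forall x y z, ~~ [&& adjacent G x y, adjacent G y z & adjacent G x z].

(* A set of arcs, each joining X and Y in either direction, no two of which
   share an endpoint. *)
Definition matching_between (T : finType) (X Y : {set T}) (M : rel T) : Prop :=
  (forall x y, M x y ->
     (x \in X) && (y \in Y) || (x \in Y) && (y \in X)) /\
  (forall x y x' y', M x y -> M x' y' ->
     (x, y) != (x', y') -> [disjoint [set x; y] & [set x'; y']]).

Definition in_M (n : nat) (H : ograph (vertex n)) : Prop :=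
  triangle_free H /\
  exists M : 'I_3 -> rel (vertex n),
    (forall i, matching_between (part n i) (part n (ordS i)) (M i)) /\
    (forall x y, H x y = [exists i, M i x y]).

(* Membership in E_n is up to isomorphism. *)
Definition in_E (n : nat) (T : finType) (G : ograph T) : Prop :=
  exists H : ograph (vertex n), in_M H /\ isomorphic G (delete (B_graph n) H).

(* Main.v *)
(* A "bad" triple is a transitive triangle or an independent set; a repeated
   vertex counts as its own nonadjacent twin, so that all counts run over
   ordered tuples without error terms.

   A sum of squares on four vertices shows that the bad triples number at least
   n^3/9: for every oriented graph on four vertices, [pot] = 162 (number of bad
   triples) - 72 - (squares attached to the six pairs) is nonnegative, and it
   vanishes only on the induced subgraphs of blow-ups of the cyclic triangle
   with at most one arc removed.  A minimizer therefore has only O(n^3)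
   quadruples with positive [pot].  By Goodman's bound it has at least n^3/18
   cyclic triangles; for one of them, abc, all but O(n) pairs uv span with abc
   only quadruples of zero [pot], and sorting the vertices by their links to
   a, b, c then gives three classes with only O(n) arcs inside classes or in the wrong direction.  Counting independent
   triples then shows that the missing arcs are o(n^2) and the classes balanced.

   Replacing a vertex v by one joined to the classes as in the blow-up bounds
   the number of bad triples at v by about n^2/9.  In terms of the out- and
   in-degrees p_i, q_i of v in class i, that number minus n^2/9 is a sum of
   nonnegative terms in e_i = p_i + q_(i+1), which forces v to look like a
   vertex of one of the classes.  Once every vertex has few deviations, each
   arc inside a class or in the wrong direction creates more transitive
   triangles than it destroys independent sets, so there is none, and the bad
   triples are exactly the triples inside classes.  A missing arc set that is
   not a union of three matchings, or that contains a triangle, would create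
   another independent triple; and moving a vertex to a smaller class shows that
   the classes are balanced. *)
Require Import Defs.
From mathcomp Require Import all_boot all_order all_algebra.
From mathcomp Require Import zify ring.

Set Implicit Arguments.
Unset Strict Implicit.
Unset Printing Implicit Defensive.

Import Order.TTheory GRing.Theory Num.Theory.
Local Open Scope ring_scope.

(** * The certificate on four vertices *)

Notation link := (option bool).

Definition flip (s : link) : link := omap negb s.

Definition state (T : finType) (G : ograph T) (x y : T) : link :=
  if G x y then Some true else if G y x then Some false else None.

Lemma state_flip (T : finType) (G : ograph T) x y :
  state G y x = flip (state G x y).
Proof.
rewrite /state; case Gxy: (G x y); last by case: (G y x).
by rewrite (negbTE (arc_antisym Gxy)).
Qed.

Lemma state_refl (T : finType) (G : ograph T) x : state G x x = None.
Proof. by rewrite /state arc_irrefl. Qed.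

(** Three mutually joined vertices form a cyclic triangle exactly when 12 and 23 agree in direction
    and 13 opposes them, hence the negated test. *)
Definition bad (s12 s13 s23 : link) : bool :=
  match s12, s13, s23 with
  | None, None, None => true
  | Some b12, Some b13, Some b23 => ~~ ((b12 == b23) && (b12 != b13))
  | _, _, _ => false
  end.

(* The arguments are the coefficients at (None, None), (None, +), (None, -),
   (+, None), ... of a linear form in the nine frequencies of pairs of links. *)
Definition form (oo op om po pp pm mo mp mm : int) (p q : link) : int :=
  match p, q with
  | None, None => oo | None, Some true => op | None, Some false => om
  | Some true, None => po | Some true, Some true => pp
  | Some true, Some false => pm
  | Some false, None => mo | Some false, Some true => mp
  | Some false, Some false => mm
  end.

(* The weights and forms come from rounding a numerical solution of the
   flag-algebra semidefinite program.  All forms vanish on the link frequencies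
   seen from a pair of the blow-up, and those for a nonadjacent pair also vanish
   on the frequencies seen from a pair whose arc was removed. *)
Definition squares_arc : seq (nat * (link -> link -> int)) :=
  [:: (4, form 4 (-2) 0 0 (-5) 0 (-2) 0 (-5));
      (25, form 0 1 0 0 (-1) 0 1 0 (-1));
      (78, form 0 0 (-1) 1 0 0 0 0 0);
      (78, form 0 (-1) 0 0 0 0 1 0 0)]%N.

Definition squares (s : link) : seq (nat * (link -> link -> int)) :=
  match s with
  | None => [:: (24, form 2 0 0 0 (-1) 0 0 0 (-1));
                (6, form 0 3 (-3) 3 4 0 (-3) 0 (-4));
                (30, form 0 1 (-1) 1 0 0 (-1) 0 0);
                (54, form 0 (-1) (-1) 1 0 0 1 0 0)]%N
  | Some true => squares_arc
  | Some false => [seq (cf.1, fun p q => cf.2 q p) | cf <- squares_arc]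
  end.

(** A square in polarized form: [p], [q] are the links from a pair to one further vertex, [p'], [q']
    those to another. Summing independently over both vertices turns each product into the square of
    a sum. *)
Definition gram (s p q p' q' : link) : int :=
  foldr (fun cf r => cf.1%:Z * (cf.2 p q * cf.2 p' q') + r) 0 (squares s).

(** The constant 72 is 4 * 162 / 9, the mean contribution of the four triples in a balanced blow-up.
    Links are read from the chosen pair towards the other two vertices, whence the flips. *)
Definition pot (s12 s13 s14 s23 s24 s34 : link) : int :=
  162 * ((bad s12 s13 s23)%:Z + (bad s12 s14 s24)%:Z
         + (bad s13 s14 s34)%:Z + (bad s23 s24 s34)%:Z) - 72
  - (gram s12 s13 s23 s14 s24
     + gram s13 s12 (flip s23) s14 s34
     + gram s14 s12 (flip s24) s13 (flip s34)
     + gram s23 (flip s12) (flip s13) s24 s34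
     + gram s24 (flip s12) (flip s14) s23 (flip s34)
     + gram s34 (flip s13) (flip s14) (flip s23) (flip s24)).

Definition forall_link (P : link -> bool) : bool :=
  [&& P None, P (Some true) & P (Some false)].

Lemma forall_linkP (P : link -> bool) : forall_link P -> forall s, P s.
Proof. by case/and3P=> ? ? ? [[]|]. Qed.

Lemma pot_ge0 s12 s13 s14 s23 s24 s34 : 0 <= pot s12 s13 s14 s23 s24 s34.
Proof.
move: s34; apply: forall_linkP; move: s24; apply: forall_linkP.
move: s23; apply: forall_linkP; move: s14; apply: forall_linkP.
move: s13; apply: forall_linkP; move: s12; apply: forall_linkP.
by vm_compute.
Qed.

Definition cls0 : 'I_3 := Ordinal (isT : (0 < 3)%N).
Definition cls1 : 'I_3 := Ordinal (isT : (1 < 3)%N).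
Definition cls2 : 'I_3 := Ordinal (isT : (2 < 3)%N).

Definition forall_class (P : 'I_3 -> bool) : bool :=
  [&& P cls0, P cls1 & P cls2].

Lemma forall_ord3 (P : 'I_3 -> Prop) : P cls0 -> P cls1 -> P cls2 -> forall i, P i.
Proof.
by move=> P0 P1 P2 [[|[|[|//]]] ltm];
   [have -> : Ordinal ltm = cls0 | have -> : Ordinal ltm = cls1
   |have -> : Ordinal ltm = cls2] => //; apply: val_inj.
Qed.

Lemma forall_classP (P : 'I_3 -> bool) : forall_class P -> forall i, P i.
Proof.
by case/and3P=> P0 P1 P2; apply: (forall_ord3 (P := fun i => P i) P0 P1 P2).
Qed.

(* The class of u from the links a->u, b->u, c->u, where a->b->c->a. *)
Definition class_of (sa sb sc : link) : 'I_3 :=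
  if (sc == Some true) || (sb == Some false) then cls0
  else if (sc == Some false) || (sa == Some true) then cls1 else cls2.

Definition model (i j : 'I_3) : link :=
  if i == j then None else Some (j == ordS i).

Definition wrong (i j : 'I_3) (s : link) : bool :=
  (s != None) && (s != model i j).

(** The quadruples are the five 4-subsets of {a, b, c, u, v}. As [pot] is a nonnegative integer, the
    computation over 3^7 link patterns verifies that a wrong pair makes at least one of them
    positive. *)
Lemma wrong_pot sau sbu scu sav sbv scv suv :
  (wrong (class_of sau sbu scu) (class_of sav sbv scv) suv)%:Z <=
  pot (Some true) (Some false) sau (Some true) sbu scu
  + pot (Some true) (Some false) sav (Some true) sbv scv
  + pot (Some true) sau sav sbu sbv suv
  + pot (Some false) sau sav scu scv suv
  + pot (Some true) sbu sbv scu scv suv.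
Proof.
move: suv; apply: forall_linkP; move: scv; apply: forall_linkP.
move: sbv; apply: forall_linkP; move: sav; apply: forall_linkP.
move: scu; apply: forall_linkP; move: sbu; apply: forall_linkP.
move: sau; apply: forall_linkP.
by vm_compute.
Qed.

(** * Averaging the certificate over ordered quadruples *)

Section Sums.
Variable T : finType.
Implicit Types F : T -> T -> T -> T -> int.

Definition sum4 F : int := \sum_x \sum_y \sum_z \sum_w F x y z w.

Lemma eq_sum4 F F' : (forall x y z w, F x y z w = F' x y z w) -> sum4 F = sum4 F'.
Proof. by move=> e; do 4!apply: eq_bigr => ? _. Qed.

Lemma sum4D F F' : sum4 (fun x y z w => F x y z w + F' x y z w) = sum4 F + sum4 F'.
Proof. by rewrite /sum4 -!big_split; do 3!(apply: eq_bigr => ? _; rewrite -?big_split). Qed.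

Lemma sum4N F : sum4 (fun x y z w => - F x y z w) = - sum4 F.
Proof. by rewrite /sum4 -sumrN; do 3!(apply: eq_bigr => ? _; rewrite -sumrN). Qed.

Lemma sum4Z (a : int) F : sum4 (fun x y z w => a * F x y z w) = a * sum4 F.
Proof. by rewrite /sum4; do 4!(rewrite mulr_sumr; apply: eq_bigr => ? _). Qed.

Lemma sum4_swap12 F : sum4 F = sum4 (fun x y z w => F y x z w).
Proof. by rewrite /sum4 exchange_big. Qed.

Lemma sum4_swap23 F : sum4 F = sum4 (fun x y z w => F x z y w).
Proof. by apply: eq_bigr => x _; rewrite exchange_big. Qed.

Lemma sum4_swap34 F : sum4 F = sum4 (fun x y z w => F x y w z).
Proof. by do 2!apply: eq_bigr => ? _; rewrite exchange_big. Qed.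

Lemma sum4_const3 (f : T -> T -> T -> int) :
  sum4 (fun x y z _ => f x y z) = #|T|%:Z * \sum_x \sum_y \sum_z f x y z.
Proof.
rewrite /sum4 mulr_sumr; apply: eq_bigr => x _.
rewrite mulr_sumr; apply: eq_bigr => y _.
rewrite mulr_sumr; apply: eq_bigr => z _.
by rewrite sumr_const -mulr_natl natz.
Qed.

Lemma sum3_const : \sum_(x : T) \sum_(y : T) \sum_(z : T) 1 = #|T|%:Z ^+ 3.
Proof.
rewrite !sumr_const natz -[_ *+ _ *+ _]mulr_natr -[_ *+ _]mulr_natr !natz.
by rewrite !exprS expr0 mulr1 mulrA.
Qed.

Lemma sum4_const : sum4 (fun _ _ _ _ => 1) = #|T|%:Z ^+ 4.
Proof.
by rewrite (sum4_const3 (fun _ _ _ => 1)) sum3_const -exprS.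
Qed.

End Sums.

Section Gram.
Variables (T : finType) (G : ograph T).

Definition bad3 (x y z : T) : bool :=
  bad (state G x y) (state G x z) (state G y z).

Definition hom_bad : int := \sum_x \sum_y \sum_z (bad3 x y z)%:Z.

Definition gramG (a b w w' : T) : int :=
  gram (state G a b) (state G a w) (state G b w) (state G a w') (state G b w').

Definition potG (x y z w : T) : int :=
  pot (state G x y) (state G x z) (state G x w)
      (state G y z) (state G y w) (state G z w).

(** For a fixed pair and a fixed form, the sum over the two further vertices factors as a square
    with a nonnegative weight. *)
Lemma sum4_gram_ge0 : 0 <= sum4 gramG.
Proof.
apply: sumr_ge0 => a _; apply: sumr_ge0 => b _; rewrite /gramG /gram.
elim: (squares _) => [|[c f] l IHl] /=; first by rewrite big1 // => w _; rewrite big1.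
under eq_bigr do rewrite big_split -!mulr_sumr /=.
rewrite big_split -mulr_sumr -mulr_suml addr_ge0 //.
by rewrite mulr_ge0 // -expr2 sqr_ge0.
Qed.

(** Renaming the summation variables identifies the four triple terms with one another, and likewise
    the six pair terms; 648 is 4 * 162. *)
Lemma sum4_pot :
  sum4 potG = 648 * #|T|%:Z * hom_bad - 72 * #|T|%:Z ^+ 4 - 6 * sum4 gramG.
Proof.
have -> : sum4 potG = sum4 (fun x y z w =>
   162 * ((bad3 x y z)%:Z + (bad3 x y w)%:Z + (bad3 x z w)%:Z + (bad3 y z w)%:Z)
   + - (72 * 1)
   + - (gramG x y z w + gramG x z y w + gramG x w y z
     + gramG y z x w + gramG y w x z + gramG z w x y)).
  apply: eq_sum4 => x y z w; rewrite /potG /pot /bad3 /gramG.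
  by rewrite -!(state_flip G) mulr1.
pose b (x y z _ : T) := (bad3 x y z)%:Z.
have Eb : sum4 b = #|T|%:Z * hom_bad by rewrite (sum4_const3 (fun x y z => (bad3 x y z)%:Z)).
rewrite !(sum4D, sum4N, sum4Z) sum4_const -[sum4 (fun x y z w => (bad3 x y z)%:Z)]/(sum4 b).
have -> : sum4 (fun x y _ w => (bad3 x y w)%:Z) = sum4 b by rewrite sum4_swap34.
have -> : sum4 (fun x _ z w => (bad3 x z w)%:Z) = sum4 b.
  by rewrite sum4_swap23 sum4_swap34.
have -> : sum4 (fun _ y z w => (bad3 y z w)%:Z) = sum4 b.
  by rewrite sum4_swap12 sum4_swap23 sum4_swap34.
have -> : sum4 (fun x y z w => gramG x z y w) = sum4 gramG by rewrite sum4_swap23.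
have -> : sum4 (fun x y z w => gramG x w y z) = sum4 gramG.
  by rewrite sum4_swap34 sum4_swap23.
have -> : sum4 (fun x y z w => gramG y z x w) = sum4 gramG.
  by rewrite sum4_swap12 sum4_swap23.
have -> : sum4 (fun x y z w => gramG y w x z) = sum4 gramG.
  by rewrite sum4_swap12 sum4_swap34 sum4_swap23.
have -> : sum4 (fun x y z w => gramG z w x y) = sum4 gramG.
  by rewrite sum4_swap23 sum4_swap12 sum4_swap34 sum4_swap23.
by rewrite Eb; ring.
Qed.

Lemma sum4_pot_le : sum4 potG <= 72 * #|T|%:Z * (9 * hom_bad - #|T|%:Z ^+ 3).
Proof. by rewrite sum4_pot; have := sum4_gram_ge0; lia. Qed.

Definition cyc (x y z : T) : bool := [&& G x y, G y z & G z x].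

(* Goodman's bound: with e = 1 on adjacent and -1 on nonadjacent pairs,
   e x y * e x z summed over the three choices of the apex is 3 on triples
   whose pairs are all alike and -1 on the others. *)
Lemma goodman :
  #|T|%:Z ^+ 3 <= 4 * (hom_bad + 2 * \sum_x \sum_y \sum_z (cyc x y z)%:Z).
Proof.
pose e x y : int := if state G x y is None then -1 else 1.
pose S3 (f : T -> T -> T -> int) := \sum_x \sum_y \sum_z f x y z.
have S3D f g : S3 (fun x y z => f x y z + g x y z) = S3 f + S3 g.
  by rewrite /S3 -!big_split; do 2!(apply: eq_bigr => ? _; rewrite -?big_split).
have S3Z a f : S3 (fun x y z => a * f x y z) = a * S3 f.
  by rewrite /S3; do 3!(rewrite mulr_sumr; apply: eq_bigr => ? _).
have S3_12 f : S3 f = S3 (fun x y z => f y x z) by rewrite /S3 exchange_big.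
have S3_23 f : S3 f = S3 (fun x y z => f x z y).
  by apply: eq_bigr => x _; rewrite exchange_big.
have S3_1 : S3 (fun _ _ _ => 1) = #|T|%:Z ^+ 3.
  exact: sum3_const.
pose E := fun x y z => e x y * e x z.
have E_ge0 : 0 <= S3 E.
  apply: sumr_ge0 => x _; under eq_bigr do rewrite -mulr_sumr.
  by rewrite -mulr_suml -expr2 sqr_ge0.
pose C := fun x y z : T => (cyc x y z)%:Z.
have : S3 (fun x y z => 4 * ((bad3 x y z)%:Z + C x y z + C y x z))
     = S3 (fun x y z => 1 + (E x y z + E y x z + E z x y)).
  apply: eq_bigr => x _; apply: eq_bigr => y _; apply: eq_bigr => z _.
  rewrite /C /E /e /cyc /bad3 (state_flip G x y) (state_flip G x z) (state_flip G y z).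
  rewrite /state; have := arc_antisym (o := G) (x := x) (y := y).
  have := arc_antisym (o := G) (x := x) (y := z).
  have := arc_antisym (o := G) (x := y) (y := z).
  case: (G x y); case: (G y x); case: (G x z); case: (G z x); case: (G y z);
    case: (G z y) => //= A B D; by [| have := A isT | have := B isT | have := D isT].
rewrite S3Z !S3D S3_1.
rewrite -[S3 (fun x y z => E y x z)](S3_12 E).
have <- : S3 E = S3 (fun x y z => E z x y) by rewrite S3_12 S3_23.
rewrite -[S3 (fun x y z => C y x z)](S3_12 C) -/(S3 C).
rewrite -[S3 (fun x y z => (bad3 x y z)%:Z)]/hom_bad.
lia.
Qed.
End Gram.

(** * Bad triples of minimizers *)

Section BadSets.
Variable T : finType.
Implicit Types G : ograph T.

Definition badset G : {set {set T}} :=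
  [set A : {set T} | (#|A| == 3) && (transitive_triangle G A || independent G A)].

Lemma independent_transitive G (A : {set T}) :
  independent G A -> ~~ transitive_triangle G A.
Proof.
move=> /forallP ind; apply/existsP => -[x /andP[xA /existsP[y /andP[yA]]]].
case/existsP=> z /andP[_ /and3P[Gxy _ _]].
by have /implyP/(_ xA)/forallP/(_ y)/implyP/(_ yA) := ind x; rewrite Gxy.
Qed.

Lemma ti_density G :
  (t_density G + i_density G = #|badset G|%:R / 'C(#|T|, 3)%:R)%R.
Proof.
rewrite /t_density /i_density /prob3 card_draws -mulrDl -natrD; congr (_%:R / _).
set X := [set A | _ & transitive_triangle G A]; set Y := [set A | _ & independent G A].
suff XY0 : X :&: Y = set0.
  by rewrite -cardsUI XY0 cards0 addn0; apply: eq_card => A; rewrite !inE -andb_orr.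
apply/setP=> A; rewrite !inE; apply/negbTE/negP.
by case/andP=> /andP[_ tA] /andP[_ /independent_transitive]; rewrite tA.
Qed.

Lemma badsetE G x y z :
  uniq [:: x; y; z] -> ([set x; y; z] \in badset G) = bad3 G x y z.
Proof.
move=> U; rewrite inE.
have -> : #|[set x; y; z]| = 3.
  move: U; rewrite /= !inE negb_or andbT => /andP[/andP[xy xz] yz].
  by rewrite -setUA cardsU1 cards2 yz !inE negb_or xy xz.
have XA : x \in [set x; y; z] by rewrite !inE eqxx.
have YA : y \in [set x; y; z] by rewrite !inE eqxx orbT.
have ZA : z \in [set x; y; z] by rewrite !inE eqxx orbT.
have trP a b c : a \in [set x; y; z] -> b \in [set x; y; z] -> c \in [set x; y; z] ->
    [&& G a b, G b c & G a c] -> transitive_triangle G [set x; y; z].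
  move=> aA bA cA H; apply/existsP; exists a; rewrite aA; apply/existsP; exists b.
  by rewrite bA; apply/existsP; exists c; rewrite cA.
have := arc_antisym (o := G) (x := x) (y := y).
have := arc_antisym (o := G) (x := x) (y := z).
have := arc_antisym (o := G) (x := y) (y := z).
move=> Ayz Axz Axy; rewrite /=; apply/idP/idP.
  case/orP.
    case/existsP=> a /andP[Ha /existsP[b /andP[Hb]]].
    case/existsP=> c /andP[Hc H]; move: Ha Hb Hc H; rewrite !inE /bad3 /state.
    by do 3![move=> /orP[/orP[]|] /eqP ->]; rewrite ?arc_irrefl ?andbF //=;
      move: Ayz Axz Axy; case: (G x y); case: (G y x); case: (G x z);
      case: (G z x); case: (G y z); case: (G z y) => //= A B C;
      first [by have := A isT | by have := B isT | by have := C isT].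
  move/forallP=> ind.
  have N a b : a \in [set x; y; z] -> b \in [set x; y; z] -> G a b = false.
    move=> aA bA; apply/negbTE.
    by have /implyP/(_ aA)/forallP/(_ b)/implyP/(_ bA) := ind a.
  by rewrite /bad3 /state !N.
rewrite /bad3 /state; case Exy: (G x y); case Eyx: (G y x);
  case Exz: (G x z); case Ezx: (G z x); case Eyz: (G y z); case Ezy: (G z y) => //= _;
  try (by have := Ayz Eyz; rewrite Ezy); try (by have := Axz Exz; rewrite Ezx);
  try (by have := Axy Exy; rewrite Eyx);
  try (apply/orP; left; first
   [ by apply: (trP x y z) => //; rewrite ?Exy ?Exz ?Eyz
   | by apply: (trP x z y) => //; rewrite ?Exy ?Exz ?Ezy
   | by apply: (trP y x z) => //; rewrite ?Eyx ?Exz ?Eyz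
   | by apply: (trP y z x) => //; rewrite ?Eyx ?Ezx ?Eyz
   | by apply: (trP z x y) => //; rewrite ?Exy ?Ezx ?Ezy
   | by apply: (trP z y x) => //; rewrite ?Eyx ?Ezx ?Ezy]).
apply/orP; right; apply/forallP => a; apply/implyP => Ha; apply/forallP => b.
apply/implyP; move: Ha; rewrite !inE.
by do 2![move=> /orP[/orP[]|] /eqP ->]; rewrite ?arc_irrefl ?Exy ?Eyx ?Exz ?Ezx ?Eyz ?Ezy.
Qed.

(** Double counting: the orderings of a 3-set are picked one vertex at a time, with 3, 2 and 1
    choices. *)
Lemma sum_uniq3 (Q : {set {set T}}) :
  (forall A, A \in Q -> #|A| = 3) ->
  (\sum_x \sum_y \sum_z (uniq [:: x; y; z] && ([set x; y; z] \in Q) : nat) = 6 * #|Q|)%N.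
Proof.
move=> Q3.
have E x y z : (uniq [:: x; y; z] && ([set x; y; z] \in Q)) =
    (\sum_(A in Q) [&& x \in A, y \in A :\ x & z \in A :\ x :\ y])%N :> nat.
  have EA A : A \in Q -> [&& x \in A, y \in A :\ x & z \in A :\ x :\ y]
      = uniq [:: x; y; z] && ([set x; y; z] == A).
    move=> AQ; apply/idP/idP.
      rewrite !inE => /and3P[xA /andP[yx yA] /and3P[zy zx zA]].
      have U : uniq [:: x; y; z].
        by rewrite /= !inE negb_or ![x == _]eq_sym ![y == z]eq_sym yx zx zy.
      rewrite U /= eqEcard (Q3 _ AQ); apply/andP; split.
        by apply/subsetP=> w; rewrite !inE => /orP[/orP[]|] /eqP ->.
      rewrite -setUA cardsU1 cards2 !inE negb_or ![x == _]eq_sym yx zx.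
      by rewrite [y == z]eq_sym zy.
    case/andP=> U /eqP <-; move: U; rewrite /= !inE negb_or => /andP[/andP[xy xz]].
    rewrite [y == x]eq_sym [z == x]eq_sym [z == y]eq_sym.
    by rewrite !eqxx xy xz andbT !orbT /= => ->.
  rewrite (eq_bigr (fun A => nat_of_bool (uniq [:: x; y; z] && ([set x; y; z] == A)))).
    case: (uniq _) => /=; last by rewrite big1.
    case: (boolP ([set x; y; z] \in Q)) => Hin.
      rewrite (bigD1 [set x; y; z]) //= eqxx big1 // => A /andP[_].
      by rewrite eq_sym => /negbTE ->.
    by rewrite big1 // => A AQ; case: eqP => // e; rewrite e AQ in Hin.
  by move=> A /EA ->.
under eq_bigr do under eq_bigr do under eq_bigr do rewrite E.
under eq_bigr do under eq_bigr do rewrite exchange_big.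
under eq_bigr do rewrite exchange_big.
rewrite exchange_big /= mulnC -sum_nat_const; apply: eq_bigr => A AQ.
transitivity (\sum_(x in A) \sum_(y in A :\ x) \sum_(z in A :\ x :\ y) 1)%N.
  rewrite [RHS]big_mkcond; apply: eq_bigr => x _; case: (x \in A) => /=; last first.
    by rewrite big1 // => y _; rewrite big1.
  rewrite [RHS]big_mkcond; apply: eq_bigr => y _; case: (y \in _) => /=; last first.
    by rewrite big1.
  by rewrite [RHS]big_mkcond; apply: eq_bigr => z _; case: (z \in _).
transitivity (\sum_(x in A) \sum_(y in A :\ x) 1)%N.
  apply: eq_bigr => x xA; apply: eq_bigr => y yA; rewrite sum1_card.
  by have := cardsD1 y (A :\ x); have := cardsD1 x A; rewrite (Q3 _ AQ) xA yA; lia.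
transitivity (\sum_(x in A) 2)%N; last by rewrite sum_nat_const (Q3 _ AQ).
apply: eq_bigr => x xA; rewrite sum1_card.
by have := cardsD1 x A; rewrite (Q3 _ AQ) xA; lia.
Qed.

Definition bad6 G : int :=
  \sum_x \sum_y \sum_z (uniq [:: x; y; z] && bad3 G x y z)%:Z.

Lemma bad6E G : bad6 G = (6 * #|badset G|)%N%:Z.
Proof.
rewrite -sum_uniq3; last by move=> A; rewrite inE => /andP[/eqP].
rewrite -natz natr_sum; apply: eq_bigr => x _; rewrite natr_sum; apply: eq_bigr => y _.
rewrite natr_sum; apply: eq_bigr => z _; rewrite natz.
by case U: (uniq _); rewrite /= ?badsetE.
Qed.

(** The additional tuples have a repeated vertex, and each of the three possible coincidences occurs
    in n^2 tuples. *)
Lemma hom_bad_le G : hom_bad G <= bad6 G + 3 * #|T|%:Z ^+ 2.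
Proof.
have E1 : \sum_(x : T) \sum_(y : T) (x == y)%:Z = #|T|%:Z.
  rewrite (eq_bigr (fun=> 1)) ?sumr_const ?natz // => x _.
  by rewrite (bigD1 x) //= eqxx big1 ?addr0 // => y; rewrite eq_sym => /negbTE ->.
have E2 : \sum_(x : T) \sum_(y : T) \sum_(z : T) (x == y)%:Z = #|T|%:Z ^+ 2.
  under eq_bigr do under eq_bigr do rewrite sumr_const -mulr_natr natz.
  by under eq_bigr do rewrite -mulr_suml; rewrite -mulr_suml E1.
have E3 : \sum_(x : T) \sum_(y : T) \sum_(z : T) (x == z)%:Z = #|T|%:Z ^+ 2.
  by rewrite -E2; apply: eq_bigr => x _; rewrite exchange_big.
have E4 : \sum_(x : T) \sum_(y : T) \sum_(z : T) (y == z)%:Z = #|T|%:Z ^+ 2.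
  by rewrite sumr_const E1 -mulr_natr natz.
have -> : 3 * #|T|%:Z ^+ 2 = \sum_(x : T) \sum_(y : T) \sum_(z : T)
    ((x == y)%:Z + (x == z)%:Z + (y == z)%:Z).
  under eq_bigr do under eq_bigr do rewrite !big_split.
  under eq_bigr do rewrite !big_split.
  by rewrite !big_split /= E2 E3 E4; ring.
rewrite -big_split; apply: ler_sum => x _; rewrite -big_split; apply: ler_sum => y _.
rewrite -big_split; apply: ler_sum => z _.
rewrite /= !inE; case: (x == y); case: (x == z); case: (y == z); by case: (bad3 _ _ _ _).
Qed.

End BadSets.

Lemma min_badset (T U : finType) (G : ograph T) (G' : ograph U) :
  minimizes_ti G -> (3 <= #|T|)%N -> #|U| = #|T| -> bad6 G <= bad6 G'.
Proof.
move=> Gmin T3 UT; have := Gmin _ G' UT; rewrite !ti_density UT.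
rewrite ler_pdivrMr ?ltr0n ?bin_gt0 // divfK; last by rewrite pnatr_eq0 -lt0n bin_gt0.
by rewrite ler_nat !bad6E; lia.
Qed.

(** * Blow-ups of the cyclic triangle *)

Lemma big_ord3 (f : 'I_3 -> int) : \sum_i f i = f cls0 + f cls1 + f cls2.
Proof.
rewrite !big_ord_recr big_ord0 /= add0r.
by congr (f _ + f _ + f _); apply: val_inj.
Qed.

Lemma bad_model i j k :
  bad (model i j) (model i k) (model j k) = (i == j) && (j == k).
Proof.
by move: i; apply: forall_ord3; move: j; apply: forall_ord3; move: k; apply: forall_ord3.
Qed.

Section Classes.
Variables (T : finType) (c : T -> 'I_3).

Definition blow_arc (x y : T) : bool := c y == ordS (c x).

Lemma blow_arc_irrefl : irreflexive blow_arc.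
Proof. by move=> x; rewrite /blow_arc; move: (c x); apply: forall_ord3. Qed.

Lemma blow_arc_antisym x y : blow_arc x y -> ~~ blow_arc y x.
Proof. by rewrite /blow_arc => /eqP ->; move: (c x); apply: forall_ord3. Qed.

Definition blow : ograph T := OGraph blow_arc_irrefl blow_arc_antisym.

Lemma state_blow x y : state blow x y = model (c x) (c y).
Proof.
rewrite /state /= /blow_arc; move: (c x) (c y).
by apply: forall_ord3; apply: forall_ord3.
Qed.

Lemma bad3_blow x y z : bad3 blow x y z = (c x == c y) && (c y == c z).
Proof. by rewrite /bad3 !state_blow bad_model. Qed.

Definition csize (i : 'I_3) : int := \sum_x (c x == i)%:Z.

Lemma csize_ge0 i : 0 <= csize i.
Proof. by apply: sumr_ge0. Qed.

Lemma sum_csize : \sum_i csize i = #|T|%:Z.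
Proof.
rewrite exchange_big -[RHS]natz -sumr_const; apply: eq_bigr => x _.
by rewrite (bigD1 (c x)) //= eqxx big1 ?addr0 // => i; rewrite eq_sym => /negbTE ->.
Qed.

Lemma sum_same3 :
  \sum_x \sum_y \sum_z ((c x == c y) && (c y == c z))%:Z = \sum_i csize i ^+ 3.
Proof.
transitivity (\sum_x \sum_i (c x == i)%:Z * (csize i * csize i)).
  apply: eq_bigr => x _; rewrite (bigD1 (c x)) //= eqxx.
  rewrite [X in _ = _ + X]big1 ?addr0 ?mul1r; last first.
    by move=> i; rewrite eq_sym => /negbTE ->; rewrite mul0r.
  rewrite mulr_suml; apply: eq_bigr => y _; rewrite mulr_sumr; apply: eq_bigr => z _.
  rewrite [c y == c x]eq_sym; case: eqP => [->|_] /=; last by rewrite mul0r.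
  by rewrite mul1r eq_sym.
rewrite exchange_big; apply: eq_bigr => i _.
by rewrite -mulr_suml !exprS expr0 mulr1.
Qed.

Lemma bad6_blow_le : bad6 blow <= \sum_i csize i ^+ 3.
Proof.
rewrite -sum_same3; do 3![apply: ler_sum => ? _]; rewrite bad3_blow.
have: forall a b : bool, (a && b)%:Z <= b%:Z by move=> [] [].
exact.
Qed.

End Classes.

Lemma csize_B n i : csize (fun v : vertex n => tag v) i = ((n + i) %/ 3)%N%:Z.
Proof.
rewrite /csize.
have := sig_big_dep (op := Monoid.ComLaw.clone _ _ +%R _) xpredT
  (fun (i : 'I_3) (_ : 'I_((n + i) %/ 3)) => true)
  (fun (k : 'I_3) (_ : 'I_((n + k) %/ 3)) => (k == i)%:Z).
rewrite /= => <-; rewrite (bigD1 i) //= [X in _ + X]big1 ?addr0 => [|j /negbTE ji].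
  by rewrite eqxx sumr_const card_ord natz.
by rewrite big1 // => ? _; rewrite ji.
Qed.

Lemma card_vertex n : #|vertex n| = n.
Proof.
have := sum_csize (fun v : vertex n => tag v).
by rewrite big_ord3 !csize_B /=; lia.
Qed.

(** No part exceeds (n + 2) / 3, so the cubes of the part sizes add up to at most (n + 2)^3 / 9. *)
Lemma bad6_B n : 9 * bad6 (B_graph n) <= (n%:Z + 2) ^+ 3.
Proof.
have : bad6 (B_graph n) <= _ := bad6_blow_le (fun v : vertex n => tag v).
rewrite big_ord3 !csize_B /= => le.
have [q [En E]] : exists q : nat, n = ((n + 0) %/ 3 + (n + 1) %/ 3 + (n + 2) %/ 3)%N /\
   [\/ [/\ (n + 0) %/ 3 = q, (n + 1) %/ 3 = q & (n + 2) %/ 3 = q],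
       [/\ (n + 0) %/ 3 = q, (n + 1) %/ 3 = q & (n + 2) %/ 3 = q.+1] |
       [/\ (n + 0) %/ 3 = q, (n + 1) %/ 3 = q.+1 & (n + 2) %/ 3 = q.+1]]%N.
  exists (n %/ 3)%N; split; first by lia.
  have : (n %% 3 < 3)%N by rewrite ltn_pmod.
  case Er: (n %% 3)%N => [|[|[|//]]] _;
    [apply: Or31 | apply: Or32 | apply: Or33]; split; lia.
move: (bad6 _) le => b le; rewrite {}En.
case: E le => -[-> -> ->]; rewrite !exprS !expr0; clear; nia.
Qed.

(** Comparison with [B_graph] bounds the left side by (n + 2)^3 + 27 n^2 = n^3 + 33 n^2 + 12 n + 8,
    and 53 = 33 + 12 + 8. *)
Lemma min_hom_bad (T : finType) (G : ograph T) :
  minimizes_ti G -> (3 <= #|T|)%N ->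
  9 * hom_bad G <= #|T|%:Z ^+ 3 + 53 * #|T|%:Z ^+ 2.
Proof.
move=> Gmin T3; have le1 := min_badset (B_graph #|T|) Gmin T3 (card_vertex _).
have := bad6_B #|T|; have := hom_bad_le G; rewrite !exprS expr0.
have : 3 <= #|T|%:Z by lia.
move: (#|T|%:Z) (bad6 _) (bad6 G) (hom_bad G) le1 => n b1 b2 h; nia.
Qed.

(** * Stability *)

(** Each summand leaves out one of the five variables, whose free summation contributes the factor
    [#|T|]. The right side has the shape of [wrong_pot]. *)
Lemma sum4_extend (T : finType) (F : T -> T -> T -> T -> int) :
  5 * #|T|%:Z * sum4 F = \sum_x \sum_y \sum_z \sum_u \sum_v
   (F x y z u + F x y z v + F x y u v + F x z u v + F y z u v).
Proof.
have E1 : \sum_x \sum_y \sum_z \sum_u \sum_(v : T) F x y z u = sum4 F *+ #|T|.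
  rewrite /sum4 -sumrMnl; apply: eq_bigr => x _; rewrite -sumrMnl; apply: eq_bigr => y _.
  rewrite -sumrMnl; apply: eq_bigr => z _; rewrite -sumrMnl; apply: eq_bigr => u _.
  by rewrite sumr_const.
have E2 : \sum_x \sum_y \sum_z \sum_(u : T) \sum_v F x y z v = sum4 F *+ #|T|.
  rewrite /sum4 -sumrMnl; apply: eq_bigr => x _; rewrite -sumrMnl; apply: eq_bigr => y _.
  by rewrite -sumrMnl; apply: eq_bigr => z _; rewrite sumr_const.
have E3 : \sum_x \sum_y \sum_(z : T) \sum_u \sum_v F x y u v = sum4 F *+ #|T|.
  rewrite /sum4 -sumrMnl; apply: eq_bigr => x _; rewrite -sumrMnl; apply: eq_bigr => y _.
  by rewrite sumr_const.
have E4 : \sum_x \sum_(y : T) \sum_z \sum_u \sum_v F x z u v = sum4 F *+ #|T|.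
  by rewrite /sum4 -sumrMnl; apply: eq_bigr => x _; rewrite sumr_const.
have E5 : \sum_(x : T) \sum_y \sum_z \sum_u \sum_v F y z u v = sum4 F *+ #|T|.
  by rewrite sumr_const.
transitivity (sum4 F *+ #|T| + sum4 F *+ #|T| + sum4 F *+ #|T| + sum4 F *+ #|T|
    + sum4 F *+ #|T|); first by rewrite -mulr_natr natz; ring.
rewrite -{1}E1 -{1}E2 -{1}E3 -{1}E4 -{1}E5.
by do 5!(rewrite -!big_split; apply: eq_bigr => ? _).
Qed.

Section Wrongs.
Variables (T : finType) (G : ograph T).

Definition wrongs (c : T -> 'I_3) : int :=
  \sum_x \sum_y (wrong (c x) (c y) (state G x y))%:Z.

Definition tri_class (x y z u : T) : 'I_3 :=
  class_of (state G x u) (state G y u) (state G z u).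

Lemma potG_ge0 x y z w : 0 <= potG G x y z w.
Proof. exact: pot_ge0. Qed.

Lemma cyc_wrongs :
  \sum_x \sum_y \sum_z (cyc G x y z)%:Z * wrongs (tri_class x y z)
  <= 5 * #|T|%:Z * sum4 (potG G).
Proof.
rewrite sum4_extend.
apply: ler_sum => x _; apply: ler_sum => y _; apply: ler_sum => z _.
rewrite /wrongs mulr_sumr; apply: ler_sum => u _; rewrite mulr_sumr; apply: ler_sum => v _.
case: (boolP (cyc G x y z)) => [/and3P[xy yz zx]|_]; last first.
  rewrite mul0r; have [Pu Pv] := (potG_ge0 x y z u, potG_ge0 x y z v).
  have [Pxy Pxz Pyz] := And3 (potG_ge0 x y u v) (potG_ge0 x z u v) (potG_ge0 y z u v).
  exact: (addr_ge0 (addr_ge0 (addr_ge0 (addr_ge0 Pu Pv) Pxy) Pxz) Pyz).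
rewrite mul1r; have := wrong_pot (state G x u) (state G y u) (state G z u)
  (state G x v) (state G y v) (state G z v) (state G u v).
have Exy : state G x y = Some true by rewrite /state xy.
have Eyz : state G y z = Some true by rewrite /state yz.
have Exz : state G x z = Some false by rewrite state_flip /state zx.
by rewrite /potG Exy Eyz Exz.
Qed.

End Wrongs.

(** An averaging argument: if every cyclic triangle produced more than L n wrong pairs, the sum in
    [cyc_wrongs] would exceed the bound coming from [sum4_pot_le]. *)
Lemma few_wrongs : exists L : nat, forall (T : finType) (G : ograph T),
  minimizes_ti G -> (212 <= #|T|)%N ->
  exists c : T -> 'I_3, wrongs G c <= L%:Z * #|T|%:Z.
Proof.
(* There are at least n^3 / 18 ordered cyclic triangles; 5 comes from [sum4_extend] and 72 * 53 from
   the bound on the sum of [potG]. The threshold 212 = 4 * 53 absorbs the quadratic error in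
   Goodman's bound. *)
exists (18 * (5 * (72 * 53)))%N => T G Gmin T212; set L := (18 * _)%N.
case: (boolP [exists x, exists y, exists z,
    cyc G x y z && (wrongs G (tri_class G x y z) <= L%:Z * #|T|%:Z)]) => [|Hn].
  by case/existsP=> x /existsP[y /existsP[z /andP[_ le]]]; exists (tri_class G x y z).
exfalso.
pose S := \sum_x \sum_y \sum_z (cyc G x y z)%:Z.
have lt : (L%:Z * #|T|%:Z + 1) * S
    <= \sum_x \sum_y \sum_z (cyc G x y z)%:Z * wrongs G (tri_class G x y z).
  rewrite mulr_sumr; apply: ler_sum => x _; rewrite mulr_sumr; apply: ler_sum => y _.
  rewrite mulr_sumr; apply: ler_sum => z _.
  case: (boolP (cyc G x y z)) => [C|_]; last by rewrite mulr0 mul0r.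
  rewrite mulr1 mul1r lezD1 ltNge; apply/negP => le.
  case/negP: Hn; apply/existsP; exists x; apply/existsP; exists y; apply/existsP.
  by exists z; rewrite C.
have le1 := cyc_wrongs G; have le2 := sum4_pot_le G; have le3 := goodman G.
have le4 := min_hom_bad Gmin (leq_trans (isT : 3 <= 212)%N T212).
rewrite -/S in le3; have n212 : 212 <= #|T|%:Z by lia.
have EL : L%:Z = 18 * (5 * (72 * 53)) by [].
move: {EL}(L%:Z) EL (#|T|%:Z) n212 S (hom_bad G) (sum4 _) (\sum_x _) lt le1 le2 le3 le4.
move=> l El n n212 s h p w lt le1 le2 le3 le4.
have n2 : 212 * n ^+ 2 <= n ^+ 3 by rewrite exprS [n ^+ 3]exprS; nia.
have s18 : n ^+ 3 <= 18 * s by lia.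
have p_le : p <= 72 * n * (53 * n ^+ 2) by apply: le_trans le2 _; apply: ler_wpM2l; lia.
have w_le : w <= 5 * n * (72 * n * (53 * n ^+ 2)).
  by apply: le_trans le1 _; apply: ler_wpM2l; lia.
have : (l * n + 1) * n ^+ 3 <= (l * n + 1) * (18 * s).
  by apply: ler_wpM2l => //; rewrite El; lia.
have n3 : 0 < n ^+ 3 by apply: exprn_gt0; lia.
have -> : (l * n + 1) * n ^+ 3 = 18 * (5 * n * (72 * n * (53 * n ^+ 2))) + n ^+ 3.
  by rewrite El !exprS expr0; ring.
lia.
Qed.

Section Offs.
Variables (T : finType) (G : ograph T) (c : T -> 'I_3).

Definition missed (x : T) (j : 'I_3) : int :=
  \sum_y [&& c y == j, c x != j & state G x y == None]%:Z.

(** The class [i] is independent of [c x], so that all three classes can be tried for [x]. *)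
Definition off (x : T) (i : 'I_3) : int :=
  \sum_y (state G x y != model i (c y))%:Z.

Definition offs : int := \sum_x off x (c x).

Lemma offsE : offs = wrongs G c + \sum_x \sum_j missed x j.
Proof.
rewrite -big_split; apply: eq_bigr => x _; rewrite exchange_big -big_split.
apply: eq_bigr => y _; rewrite big_ord3 /wrong /=.
move: (c x) (c y) (state G x y); apply: forall_ord3; apply: forall_ord3;
  by case=> [[]|].
Qed.

(** Without wrong pairs, a tuple inside a class is bad, and so is a tuple where x misses both y and
    z in one other class; the latter tuples give the squares of [missed]. The last term charges
    every wrong pair in each of its three positions. *)
Lemma hom_bad_lower :
  \sum_i csize c i ^+ 3 + \sum_x \sum_j missed x j ^+ 2
  <= hom_bad G + 3 * #|T|%:Z * wrongs G c.
Proof.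
pose w x y := (wrong (c x) (c y) (state G x y))%:Z.
have -> : 3 * #|T|%:Z * wrongs G c =
  \sum_x \sum_y \sum_z (w x y + w x z + w y z).
  under eq_bigr do under eq_bigr do rewrite !big_split.
  under eq_bigr do rewrite !big_split.
  rewrite !big_split /=.
  have -> : \sum_(x : T) \sum_y \sum_z w y z = #|T|%:Z * wrongs G c.
    by rewrite sumr_const -mulr_natl natz.
  have -> : \sum_x \sum_(y : T) \sum_z w x z = #|T|%:Z * wrongs G c.
    by rewrite mulr_sumr; apply: eq_bigr => x _; rewrite sumr_const -mulr_natl natz.
  have -> : \sum_x \sum_y \sum_(z : T) w x y = #|T|%:Z * wrongs G c.
    rewrite mulr_sumr; apply: eq_bigr => x _; rewrite mulr_sumr.
    by apply: eq_bigr => y _; rewrite sumr_const -mulr_natl natz.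
  by ring.
rewrite -sum_same3 -!big_split; apply: ler_sum => x _.
have -> : \sum_j missed x j ^+ 2 = \sum_y \sum_z \sum_j
    [&& c y == j, c x != j & state G x y == None]%:Z
    * [&& c z == j, c x != j & state G x z == None]%:Z.
  under eq_bigr do rewrite expr2 big_distrlr.
  by rewrite exchange_big; apply: eq_bigr => y _; rewrite exchange_big.
rewrite -!big_split; apply: ler_sum => y _; rewrite -!big_split; apply: ler_sum => z _.
rewrite big_ord3 /w /bad3 /=.
move: (state G x y); apply: forall_linkP; move: (state G x z); apply: forall_linkP.
move: (state G y z); apply: forall_linkP; move: (c x); apply: forall_classP.
move: (c y); apply: forall_classP; move: (c z); apply: forall_classP.
by vm_compute.
Qed.

End Offs.


(** The two sides of the second inequality differ by three times the sum of the m_i (3 m_i - n)^2;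
    the first inequality follows from the second. *)
Lemma cube_mean (m0 m1 m2 : int) : 0 <= m0 -> 0 <= m1 -> 0 <= m2 ->
  let n := m0 + m1 + m2 in
  n ^+ 3 <= 9 * (m0 ^+ 3 + m1 ^+ 3 + m2 ^+ 3) /\
  2 * n * ((3 * m0 - n) ^+ 2 + (3 * m1 - n) ^+ 2 + (3 * m2 - n) ^+ 2)
    <= 27 * (m0 ^+ 3 + m1 ^+ 3 + m2 ^+ 3) - 3 * n ^+ 3.
Proof.
move=> h0 h1 h2 n.
have p0 : 0 <= m0 * (3 * m0 - n) ^+ 2 by rewrite mulr_ge0 ?sqr_ge0.
have p1 : 0 <= m1 * (3 * m1 - n) ^+ 2 by rewrite mulr_ge0 ?sqr_ge0.
have p2 : 0 <= m2 * (3 * m2 - n) ^+ 2 by rewrite mulr_ge0 ?sqr_ge0.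
have second : 2 * n * ((3 * m0 - n) ^+ 2 + (3 * m1 - n) ^+ 2 + (3 * m2 - n) ^+ 2)
    <= 27 * (m0 ^+ 3 + m1 ^+ 3 + m2 ^+ 3) - 3 * n ^+ 3.
  rewrite -subr_ge0 (_ : _ - _ = 3 * (m0 * (3 * m0 - n) ^+ 2
    + m1 * (3 * m1 - n) ^+ 2 + m2 * (3 * m2 - n) ^+ 2)); last by rewrite /n; ring.
  by rewrite mulr_ge0 // !addr_ge0.
split=> //; have : 0 <= 27 * (m0 ^+ 3 + m1 ^+ 3 + m2 ^+ 3) - 3 * n ^+ 3.
  apply: le_trans second; rewrite !mulr_ge0 ?addr_ge0 ?sqr_ge0 //.
by move: (n ^+ 3) (_ + m2 ^+ 3) => a b; clear; lia.
Qed.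

Lemma close_to_blow (k : nat) : exists n0 : nat, forall (T : finType) (G : ograph T),
  minimizes_ti G -> (n0 < #|T|)%N ->
  exists c : T -> 'I_3, k%:Z * offs G c <= #|T|%:Z ^+ 2
    /\ forall i, k%:Z * `|3 * csize c i - #|T|%:Z| <= #|T|%:Z.
Proof.
have [L HL] := few_wrongs.
(* Beyond this threshold both (k^2 K + 6 k L) n and 3 k^2 K n are at most n^2, where K = 53 + 27 L
   collects the quadratic errors. *)
exists (212 + (3 * (k * k * (53 + 27 * L)) + 6 * (k * L)))%N => T G Gmin Tn.
have [|c Hc] := HL T G Gmin; first by lia.
have h1 : 9 * hom_bad G <= #|T|%:Z ^+ 3 + 53 * #|T|%:Z ^+ 2.
  by apply: min_hom_bad => //; lia.
have h2 := hom_bad_lower G c; have Eoffs := offsE G c.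
have Esum := sum_csize c; rewrite big_ord3 in Esum; rewrite big_ord3 in h2.
have [[m0 m1] m2] := (csize_ge0 c cls0, csize_ge0 c cls1, csize_ge0 c cls2).
have := cube_mean m0 m1 m2; rewrite /= Esum => -[c1 c2].
have M2_ge0 : 0 <= \sum_x \sum_j missed G c x j ^+ 2.
  by do 2!(apply: sumr_ge0 => ? _); apply: sqr_ge0.
(* Expanding the sum of (3 k missed - n)^2 over the 3n pairs of a vertex and a class bounds the sum
   of [missed] by the sum of its squares. *)
have sq : 0 <= 9 * k%:Z ^+ 2 * (\sum_x \sum_j missed G c x j ^+ 2)
    - 6 * k%:Z * #|T|%:Z * (\sum_x \sum_j missed G c x j) + 3 * #|T|%:Z ^+ 3.
  have : 0 <= \sum_x \sum_j (3 * k%:Z * missed G c x j - #|T|%:Z) ^+ 2.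
    by do 2!(apply: sumr_ge0 => ? _); apply: sqr_ge0.
  have -> : \sum_x \sum_j (3 * k%:Z * missed G c x j - #|T|%:Z) ^+ 2 =
    \sum_x \sum_j (9 * k%:Z ^+ 2 * missed G c x j ^+ 2
       + (- (6 * k%:Z * #|T|%:Z) * missed G c x j + #|T|%:Z ^+ 2)).
    by do 2!(apply: eq_bigr => ? _); ring.
  under eq_bigr do rewrite !big_split -!mulr_sumr sumr_const card_ord /=.
  rewrite !big_split -!mulr_sumr sumr_const /= => le; apply: le_trans le _.
  rewrite -mulr_natr natz -[_ *+ 3]mulr_natr le_eqVlt; apply/orP; left.
  by apply/eqP; ring.
have n1 : 212 + (3 * (k%:Z ^+ 2 * (53 + 27 * L%:Z)) + 6 * (k%:Z * L%:Z)) < #|T|%:Z.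
  by rewrite expr2; clear -Tn; lia.
have k0 : 0 <= k%:Z by []; have L0 : 0 <= L%:Z by [].
have n0 : 0 < #|T|%:Z by clear -Tn; lia.
set M2 := (\sum_x \sum_j missed G c x j ^+ 2) in h2 sq M2_ge0.
exists c; rewrite Eoffs; clear Eoffs.
set M1 := (\sum_x \sum_j missed G c x j) in sq *.
move: (wrongs G c) (hom_bad G) M1 M2 Hc h1 h2 sq M2_ge0 => W h M1 M2 Hc h1 h2 sq M2_ge0.
clear Tn HL Gmin.
move: (csize c) m0 m1 m2 Esum c1 c2 h2 => m m0 m1 m2 Esum c1 c2 h2.
move: (k%:Z) (L%:Z) (#|T|%:Z) k0 L0 n0 n1 Hc h1 h2 sq Esum c1 c2.
move=> {}k l n k0 l0 n0 n1 Hc h1 h2 sq Esum c1 c2.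
set S := (_ + m cls2 ^+ 3) in h2 c1 c2.
have [K EK] : exists K, K = 53 + 27 * l by eexists.
have K0 : 0 <= K by clear -EK l0; lia.
rewrite -EK in n1.
have nW : n * W <= l * n ^+ 2 by rewrite expr2 mulrCA ler_pM2l.
have M2le : 9 * S + 9 * M2 <= n ^+ 3 + K * n ^+ 2.
  by rewrite EK; clear -h1 h2 nW; nia.
split.
  have kM2 : k ^+ 2 * (9 * M2) <= k ^+ 2 * (K * n ^+ 2).
    by rewrite ler_wpM2l ?sqr_ge0 //; clear -M2le c1; lia.
  have kW : k * W <= k * (l * n) by rewrite ler_wpM2l.
  have : n * (6 * (k * M1)) <= n * (k ^+ 2 * K * n + 3 * n ^+ 2).
    by clear -kM2 sq; lia.
  rewrite ler_pM2l // => le.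
  have : (k ^+ 2 * K + 6 * (k * l)) * n <= n * n.
    have k2K : 0 <= k ^+ 2 * K by rewrite mulr_ge0 ?sqr_ge0.
    by rewrite ler_wpM2r 1?ltW //; clear -n1 k2K; lia.
  by rewrite expr2 in le *; clear -le kW; lia.
have c3 : n * (2 * ((3 * m cls0 - n) ^+ 2 + (3 * m cls1 - n) ^+ 2
   + (3 * m cls2 - n) ^+ 2)) <= n * (3 * K * n).
  have -> : n * (3 * K * n) = 3 * (K * n ^+ 2) by ring.
  rewrite mulrCA mulrA; apply: le_trans c2 _.
  by clear -M2le M2_ge0; lia.
rewrite ler_pM2l // in c3.
have {}c3 i : 2 * (3 * m i - n) ^+ 2 <= 3 * K * n.
  have [[q0 q1] q2] := (sqr_ge0 (3 * m cls0 - n), sqr_ge0 (3 * m cls1 - n),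
    sqr_ge0 (3 * m cls2 - n)).
  by move: i; clear -c3 q0 q1 q2; apply: forall_ord3; lia.
(* A size deviation above n / k would have a square above n^2 / k^2, against the bound linear in
   n. *)
move=> i; rewrite leNgt; apply/negP => lt.
have k2 : k ^+ 2 * (2 * (3 * m i - n) ^+ 2) <= k ^+ 2 * (3 * K * n).
  by rewrite ler_wpM2l ?sqr_ge0.
have : 3 * (k ^+ 2 * K) * n <= n * n.
  have kl : 0 <= k * l by rewrite mulr_ge0.
  by rewrite ler_wpM2r 1?ltW //; clear -n1 kl; lia.
have : n * n < k * `|3 * m i - n| * (k * `|3 * m i - n|) by rewrite ltr_pM // ltW.
rewrite (_ : _ * (k * _) = k ^+ 2 * `|3 * m i - n| ^+ 2); last by ring.
have nn : 0 < n * n by rewrite mulr_gt0.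
by rewrite real_normK ?num_real //; clear -k2 nn; lia.
Qed.

(** * Local structure at a vertex *)

Lemma bad3_swap12 (T : finType) (G : ograph T) x y z : bad3 G y x z = bad3 G x y z.
Proof.
rewrite /bad3 (state_flip G x y).
by move: (state G x y) (state G x z) (state G y z) => [[]|] [[]|] [[]|].
Qed.

Lemma bad3_swap23 (T : finType) (G : ograph T) x y z : bad3 G x z y = bad3 G x y z.
Proof.
rewrite /bad3 (state_flip G y z).
by move: (state G x y) (state G x z) (state G y z) => [[]|] [[]|] [[]|].
Qed.

Section Rejoin.
Variables (T : finType) (G : ograph T) (c : T -> 'I_3) (v : T) (i : 'I_3).

Definition bad_at (H : ograph T) : int :=
  \sum_y \sum_z (uniq [:: v; y; z] && bad3 H v y z)%:Z.

(** Only triples through [v] change, and [v] can stand in any of three positions of an ordered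
    triple. *)
Lemma bad6_local (H : ograph T) :
  (forall x y, x != v -> y != v -> state H x y = state G x y) ->
  bad6 H - bad6 G = 3 * (bad_at H - bad_at G).
Proof.
move=> GH; pose u (K : ograph T) x y z := (uniq [:: x; y; z] && bad3 K x y z)%:Z.
pose D x y z : int := u H x y z - u G x y z.
have uS12 K x y z : u K y x z = u K x y z.
  by rewrite /u bad3_swap12 /= !inE [y == x]eq_sym !negb_or; do 3!case: (_ == _).
have uS23 K x y z : u K x z y = u K x y z.
  by rewrite /u bad3_swap23 /= !inE [z == y]eq_sym !negb_or; do 3!case: (_ == _).
have DS12 x y z : D y x z = D x y z by rewrite /D !(uS12 _ x y z).
have DS23 x y z : D x z y = D x y z by rewrite /D !(uS23 _ x y z).
have -> : bad6 H - bad6 G = \sum_x \sum_y \sum_z D x y z.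
  rewrite -sumrB; apply: eq_bigr => x _; rewrite -sumrB; apply: eq_bigr => y _.
  by rewrite -sumrB.
have E1 : \sum_x \sum_y \sum_z (x == v)%:Z * D x y z = \sum_y \sum_z D v y z.
  rewrite (bigD1 v) //= [X in _ + X]big1 => [|x /negbTE ->].
    by rewrite addr0 eqxx; do 2!apply: eq_bigr => ? _; rewrite mul1r.
  by do 2!rewrite big1 // => ? _; rewrite mul0r.
have -> : bad_at H - bad_at G = \sum_y \sum_z D v y z.
  by rewrite -sumrB; apply: eq_bigr => x _; rewrite -sumrB.
transitivity (\sum_x \sum_y \sum_z (x == v)%:Z * D x y z
  + \sum_x \sum_y \sum_z (y == v)%:Z * D x y z
  + \sum_x \sum_y \sum_z (z == v)%:Z * D x y z).
  rewrite -!big_split; apply: eq_bigr => x _; rewrite -!big_split.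
  apply: eq_bigr => y _; rewrite -!big_split; apply: eq_bigr => z _ /=.
  rewrite -!mulrDl.
  have [xv|xv] := eqVneq x v; have [yv|yv] := eqVneq y v; have [zv|zv] := eqVneq z v;
    rewrite ?mul1r ?mul0r //= /D /u /= !inE ?xv ?yv ?zv ?eqxx ?orbT //=.
    by rewrite andbF subrr mulr0.
  by rewrite /bad3 !GH // subrr.
have E2 : \sum_x \sum_y \sum_z (y == v)%:Z * D x y z = \sum_y \sum_z D v y z.
  rewrite -E1 exchange_big; apply: eq_bigr => x _; apply: eq_bigr => y _.
  by apply: eq_bigr => z _; rewrite DS12.
have E3 : \sum_x \sum_y \sum_z (z == v)%:Z * D x y z = \sum_y \sum_z D v y z.
  rewrite -E2; apply: eq_bigr => x _; rewrite exchange_big; apply: eq_bigr => y _.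
  by apply: eq_bigr => z _; rewrite DS23.
by rewrite E1 E2 E3; ring.
Qed.

Definition rejoin_arc (x y : T) : bool :=
  if x == v then (y != v) && (c y == ordS i)
  else if y == v then i == ordS (c x) else G x y.

Lemma rejoin_irrefl : irreflexive rejoin_arc.
Proof. by move=> x; rewrite /rejoin_arc arc_irrefl; case: eqP. Qed.

Lemma rejoin_antisym x y : rejoin_arc x y -> ~~ rejoin_arc y x.
Proof.
rewrite /rejoin_arc; case: (x == v); case: (y == v) => //=; last exact: arc_antisym.
  by move=> /eqP ->; move: i; apply: forall_ord3.
by move=> /eqP ->; move: (c x); apply: forall_ord3.
Qed.

Definition rejoin : ograph T := OGraph rejoin_irrefl rejoin_antisym.

(** After rejoining, a pair yz whose link follows the model is bad with [v] only if both ends lie in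
    class [i]; every other pair is counted in [offs]. *)
Lemma bad_at_rejoin : bad_at rejoin <= csize c i ^+ 2 + offs G c.
Proof.
rewrite expr2 /csize big_distrlr -big_split; apply: ler_sum => y _.
rewrite /off -big_split; apply: ler_sum => z _.
case: (boolP (uniq [:: v; y; z])) => [|_]; last first.
  by rewrite andFb addr_ge0 ?mulr_ge0.
rewrite /= !inE negb_or andbT => /andP[/andP[vy vz] yz].
have E w : v != w -> state rejoin v w = model i (c w).
  rewrite eq_sym => wv; rewrite /state /= /rejoin_arc (negbTE wv) eqxx /=.
  by move: i (c w); apply: forall_ord3; apply: forall_ord3.
have -> : bad3 rejoin v y z = bad (model i (c y)) (model i (c z)) (state G y z).
  rewrite /bad3 !E //; congr bad; rewrite /state /= /rejoin_arc.
  by rewrite ![_ == v]eq_sym (negbTE vy) (negbTE vz).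
case: (eqVneq (state G y z)) => [->|_] /=; last first.
  by case: bad; rewrite ?lerDr ?addr_ge0 ?mulr_ge0.
rewrite bad_model addr0; case: (eqVneq i (c y)) => [<-|_] /=; last by rewrite mulr_ge0.
by rewrite mul1r eq_sym.
Qed.

Definition cnt (P : pred link) (j : 'I_3) : int :=
  \sum_y ((c y == j) && P (state G v y))%:Z.

Let p := cnt (pred1 (Some true)).
Let q := cnt (pred1 (Some false)).
Let z := cnt (pred1 None).

Lemma cnt_ge0 P j : 0 <= cnt P j.
Proof. by apply: sumr_ge0. Qed.

Lemma cnt_sum j : p j + q j + z j = csize c j.
Proof.
rewrite -!big_split; apply: eq_bigr => y _ /=.
by case: (c y == j) => //; case: (state G v y) => [[]|].
Qed.

Lemma off_cnt j : off G c v j = p j + q j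
  + (csize c (ordS j) - p (ordS j)) + (csize c (ordS (ordS j)) - q (ordS (ordS j))).
Proof.
rewrite -!sumrB -!big_split; apply: eq_bigr => y _ /=.
move: (state G v y) (c y) j => s j k; apply/eqP; move: k; apply: forall_classP.
move: j; apply: forall_classP; move: s; apply: forall_linkP.
by vm_compute.
Qed.

(** Two nonneighbours of [v] in one class form an independent triple with it. For neighbours y in
    class j and w in the next class, the arc yw gives a transitive triangle unless v->y and w->v,
    which is the subtracted product. Deviating pairs cost [offs], and coincidences cost 3n. *)
Lemma bad_at_lower :
  \sum_j (z j ^+ 2 + 2 * ((p j + q j) * (p (ordS j) + q (ordS j)) - p j * q (ordS j)))
  <= bad_at G + offs G c + 3 * #|T|%:Z.
Proof.
pose I j P y := ((c y == j) && P (state G v y))%:Z.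
pose P j := I j (pred1 (Some true)); pose Q j := I j (pred1 (Some false)).
pose Z j := I j (pred1 None).
have -> : \sum_j (z j ^+ 2 + 2 * ((p j + q j) * (p (ordS j) + q (ordS j)) - p j * q (ordS j)))
  = \sum_y \sum_w \sum_j (Z j y * Z j w
     + (P j y + Q j y) * (P (ordS j) w + Q (ordS j) w)
     + (P (ordS j) y + Q (ordS j) y) * (P j w + Q j w)
     + - P j y * Q (ordS j) w + - Q (ordS j) y * P j w).
  under [RHS]eq_bigr do rewrite exchange_big.
  rewrite [RHS]exchange_big; apply: eq_bigr => j _ /=.
  under [RHS]eq_bigr do rewrite !big_split -!mulr_sumr !big_split /=.
  rewrite !big_split -!mulr_suml !big_split /= !sumrN.
  rewrite -[\sum_(y : T) Z j y]/(z j) -[\sum_(y : T) P j y]/(p j) -[\sum_(y : T) Q j y]/(q j).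
  rewrite -[\sum_(y : T) P (ordS j) y]/(p (ordS j)).
  rewrite -[\sum_(y : T) Q (ordS j) y]/(q (ordS j)).
  ring.
have E0 (x : T) : \sum_y (x == y)%:Z = 1.
  by rewrite (bigD1 x) //= eqxx big1 ?addr0 // => y; rewrite eq_sym => /negbTE ->.
have E1 : \sum_y \sum_(w : T) (v == y)%:Z = #|T|%:Z.
  by rewrite exchange_big; under eq_bigr do rewrite E0; rewrite sumr_const natz.
have E2 : \sum_(y : T) \sum_w (v == w)%:Z = #|T|%:Z.
  by under eq_bigr do rewrite E0; rewrite sumr_const natz.
have E3 : \sum_(y : T) \sum_w (y == w)%:Z = #|T|%:Z.
  by under eq_bigr do rewrite E0; rewrite sumr_const natz.
have -> : 3 * #|T|%:Z = \sum_(y : T) \sum_(w : T) ((v == y)%:Z + (v == w)%:Z + (y == w)%:Z).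
  under eq_bigr do rewrite !big_split.
  by rewrite !big_split /= E1 E2 E3; ring.
rewrite -!big_split; apply: ler_sum => y _; rewrite -!big_split; apply: ler_sum => w _.
have Bu (b b1 b2 b3 : bool) (d : int) :
  b%:Z + d <= (~~ b1 && ~~ b2 && ~~ b3 && b)%:Z + d + (b1%:Z + b2%:Z + b3%:Z).
  by move: b b1 b2 b3 => [] [] [] [] /=; lia.
have -> : uniq [:: v; y; w] = ~~ (v == y) && ~~ (v == w) && ~~ (y == w).
  by rewrite /= !inE negb_or andbT.
apply: le_trans (Bu _ _ _ _ _); rewrite big_ord3 /P /Q /Z /I /bad3.
move: (c w); apply: forall_classP; move: (c y); apply: forall_classP.
move: (state G y w); apply: forall_linkP; move: (state G v w); apply: forall_linkP.
move: (state G v y); apply: forall_linkP.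
by vm_compute.
Qed.

Lemma bad_at_min : minimizes_ti G -> (3 <= #|T|)%N ->
  bad_at G <= csize c i ^+ 2 + offs G c.
Proof.
move=> Gmin T3; apply: le_trans bad_at_rejoin.
have := min_badset rejoin Gmin T3 erefl; rewrite -subr_ge0 bad6_local ?pmulr_rge0 ?subr_ge0 //.
by move=> x y /negbTE xv /negbTE yv; rewrite /state /= /rejoin_arc xv yv.
Qed.

End Rejoin.

(** Put e_i = p_i + q_(i+1). If all m_i equal n / 3, then 18 times the left side of the last
    hypothesis minus m0^2 is exactly the bracket in the conclusion plus 9 times the sum of the (p_i
    - q_(i+1))^2. Unequal sizes only add terms of order n^2 / k. *)
Lemma cluster_gap (k n off p0 p1 p2 q0 q1 q2 m0 m1 m2 : int) :
  0 <= p0 -> 0 <= p1 -> 0 <= p2 -> 0 <= q0 -> 0 <= q1 -> 0 <= q2 ->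
  p0 + q0 <= m0 -> p1 + q1 <= m1 -> p2 + q2 <= m2 ->
  1 <= k -> 9 * k <= n -> k * off <= n ^+ 2 ->
  k * `|3 * m0 - n| <= n -> k * `|3 * m1 - n| <= n -> k * `|3 * m2 - n| <= n ->
  (m0 - p0 - q0) ^+ 2 + (m1 - p1 - q1) ^+ 2 + (m2 - p2 - q2) ^+ 2
  + 2 * ((p0 + q0) * (p1 + q1) + (p1 + q1) * (p2 + q2) + (p2 + q2) * (p0 + q0)
         - p0 * q1 - p1 * q2 - p2 * q0) <= m0 ^+ 2 + 2 * off + 3 * n ->
  k * ((3 * (p0 + q1 + (p1 + q2) + (p2 + q0)) - 2 * n) ^+ 2
       + 18 * ((p0 + q1) * (p1 + q2) + (p1 + q2) * (p2 + q0) + (p2 + q0) * (p0 + q1)))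
    <= 60 * n ^+ 2.
Proof.
move=> p0_ge p1_ge p2_ge q0_ge q1_ge q2_ge le0 le1 le2 k1 nk koff d0 d1 d2 F.
have n0 : 0 <= n by move: k1 nk; clear; lia.
have dev d a : k * `|d| <= n -> `|a| <= n -> k * `|d * a| <= n ^+ 2.
  by move=> kd an; rewrite normrM mulrA expr2 ler_pM // mulr_ge0 //; lia.
have an m a : 0 <= a -> a <= m -> k * `|3 * m - n| <= n -> `|n - 3 * a| <= n.
  move=> a0 am km; have : `|3 * m - n| <= n.
    by apply: le_trans km; rewrite ler_peMl.
  by move: a0 am n0; clear; lia.
have dn m : k * `|3 * m - n| <= n -> `|3 * m - n| <= n.
  by move=> km; apply: le_trans km; rewrite ler_peMl.
have b0 : k * `|(3 * m0 - n) * (n - 3 * (p0 + q0))| <= n ^+ 2.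
  by apply: dev => //; apply: an le0 d0; apply: addr_ge0.
have b1 : k * `|(3 * m1 - n) * (n - 3 * (p1 + q1))| <= n ^+ 2.
  by apply: dev => //; apply: an le1 d1; apply: addr_ge0.
have b2 : k * `|(3 * m2 - n) * (n - 3 * (p2 + q2))| <= n ^+ 2.
  by apply: dev => //; apply: an le2 d2; apply: addr_ge0.
have b3 : k * `|(3 * m0 - n) * (3 * m0 - n)| <= n ^+ 2 by apply: dev; rewrite ?dn.
have b4 : k * `|(3 * m0 - n) * n| <= n ^+ 2 by apply: dev; rewrite // ger0_norm.
have b5 : 0 <= (3 * m0 - n) ^+ 2 + (3 * m1 - n) ^+ 2 + (3 * m2 - n) ^+ 2.
  by rewrite !addr_ge0 ?sqr_ge0.
have b6 : 0 <= (p0 - q1) ^+ 2 + (p1 - q2) ^+ 2 + (p2 - q0) ^+ 2 by rewrite !addr_ge0 ?sqr_ge0.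
have b7 : 9 * (k * n) <= n * n by have := ler_wpM2r n0 nk; rewrite mulrA.
have key : (3 * (p0 + q1 + (p1 + q2) + (p2 + q0)) - 2 * n) ^+ 2
   + 18 * ((p0 + q1) * (p1 + q2) + (p1 + q2) * (p2 + q0) + (p2 + q0) * (p0 + q1))
  <= 4 * ((3 * m0 - n) * n) + 2 * ((3 * m0 - n) * (3 * m0 - n)) + 36 * off + 54 * n
     - 4 * ((3 * m0 - n) * (n - 3 * (p0 + q0)) + (3 * m1 - n) * (n - 3 * (p1 + q1))
            + (3 * m2 - n) * (n - 3 * (p2 + q2))).
  rewrite -subr_ge0 in F; rewrite -subr_ge0; set lhs := (X in 0 <= X - _) in F.
  have h := addr_ge0 (addr_ge0 (mulr_ge0 (isT : 0 <= 18 :> int) F)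
    (mulr_ge0 (isT : 0 <= 2 :> int) b5)) (mulr_ge0 (isT : 0 <= 9 :> int) b6).
  by apply: le_trans h _; rewrite /lhs le_eqVlt; apply/orP; left; apply/eqP; ring.
have := ler_wpM2l (le_trans ler01 k1) key.
have absk x : k * `|x| <= n ^+ 2 -> k * x <= n ^+ 2 /\ - (k * x) <= n ^+ 2.
  move=> kx; have k0 := le_trans ler01 k1.
  have h1 := ler_wpM2l k0 (ler_norm x); have := ler_wpM2l k0 (ler_norm (- x)).
  by rewrite normrN mulrN => h2; split; [apply: le_trans h1 kx | apply: le_trans h2 kx].
have [_ b0'] := absk _ b0; have [_ b1'] := absk _ b1; have [_ b2'] := absk _ b2.
have [b3' _] := absk _ b3; have [b4' _] := absk _ b4.
(* Multiplied by [k], the terms of [key] contribute 4 + 2 + 36 + 6 + 3 * 4 = 60 times n^2. *)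
move=> h; apply: le_trans h _; clear -b0' b1' b2' b3' b4' koff b7.
move: b0' b1' b2' b3' b4' koff b7; rewrite -[n * n]expr2; move: (n ^+ 2) => nn.
move: (_ * (n - 3 * (p0 + q0))) (_ * (n - 3 * (p1 + q1))) (_ * (n - 3 * (p2 + q2))).
move=> x0 x1 x2; move: (_ * (3 * m0 - n)) => x3; move: ((3 * m0 - n) * n) => x4.
lia.
Qed.

(** The e_i add up to nearly 2n / 3 while their pairwise products are tiny, so the largest, e1,
    carries almost all of it. Then nearly all of class 1 are out-neighbours and nearly all of class
    2 are in-neighbours, as for a vertex of class 0. *)
Lemma cluster_pick (k n p0 p1 p2 q0 q1 q2 m1 m2 : int) :
  0 <= p0 -> 0 <= p1 -> 0 <= p2 -> 0 <= q0 -> 0 <= q1 -> 0 <= q2 ->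
  100 * 1000 <= k -> 0 < n ->
  k * ((3 * (p0 + q1 + (p1 + q2) + (p2 + q0)) - 2 * n) ^+ 2
       + 18 * ((p0 + q1) * (p1 + q2) + (p1 + q2) * (p2 + q0) + (p2 + q0) * (p0 + q1)))
    <= 60 * n ^+ 2 ->
  p0 + q1 <= p1 + q2 -> p2 + q0 <= p1 + q2 ->
  1000 * `|3 * m1 - n| <= n -> 1000 * `|3 * m2 - n| <= n ->
  60 * (p0 + q0 + (m1 - p1) + (m2 - q2)) <= n.
Proof.
move=> p0_ge p1_ge p2_ge q0_ge q1_ge q2_ge k_ge n0.
have [e0 E0] : exists e0, e0 = p0 + q1 by eexists.
have [e1 E1] : exists e1, e1 = p1 + q2 by eexists.
have [e2 E2] : exists e2, e2 = p2 + q0 by eexists.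
rewrite -E0 -E1 -E2 => gap e01 e21 d1 d2.
have e0_ge : 0 <= e0 by rewrite E0 addr_ge0.
have e2_ge : 0 <= e2 by rewrite E2 addr_ge0.
have e1_ge : 0 <= e1 by apply: le_trans e01.
have {gap} : 100 * 1000 * ((3 * (e0 + e1 + e2) - 2 * n) ^+ 2
    + 18 * (e0 * e1 + e1 * e2 + e2 * e0)) <= 60 * n ^+ 2.
  apply: le_trans gap; apply: ler_wpM2r k_ge.
  by rewrite addr_ge0 ?sqr_ge0 // mulr_ge0 // !addr_ge0 ?mulr_ge0.
set X := 3 * _ - 2 * n => gap.
have f02 : 0 <= e2 * e0 by rewrite mulr_ge0.
have f01 : 0 <= e0 * e1 by rewrite mulr_ge0.
have f12 : 0 <= e1 * e2 by rewrite mulr_ge0.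
have X_le : - n <= 40 * X.
  rewrite leNgt; apply/negP => lt; have lt' : n < - (40 * X) by rewrite ltrNr.
  have : n * n < - (40 * X) * - (40 * X) by rewrite ltr_pM // ltW.
  rewrite (_ : - _ * - _ = 1600 * X ^+ 2); last by ring.
  rewrite -expr2; move: gap f02 f01 f12 (sqr_ge0 n).
  by move: (n ^+ 2) (X ^+ 2) (e2 * e0) (e0 * e1) (e1 * e2); clear; lia.
have e1n : n <= 5 * e1 by move: X_le e01 e21 n0; rewrite /X; clear; lia.
have r_le : 6000 * (e0 + e2) <= n.
  have h1 : n * (e0 + e2) <= 5 * e1 * (e0 + e2) by rewrite ler_wpM2r ?addr_ge0.
  have h2 : 0 <= X ^+ 2 by apply: sqr_ge0.
  have : n * (6000 * (e0 + e2)) <= n * n.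
    move: h1 h2 gap f02; rewrite -[n * n]expr2 -[5 * _ * _]mulrA.
    have -> : e0 * e1 + e1 * e2 + e2 * e0 = e1 * (e0 + e2) + e2 * e0 by ring.
    rewrite [n * (6000 * _)]mulrCA.
    by move: (X ^+ 2) (n ^+ 2) (e1 * _) (n * _) (e2 * e0); clear; lia.
  by rewrite ler_pM2l.
have pe : p0 + q0 <= e0 + e2 by rewrite E0 E2; move: q1_ge p2_ge; clear; lia.
have [m1_le m2_le] : 1000 * (3 * m1 - n) <= n /\ 1000 * (3 * m2 - n) <= n.
  by split; [apply: le_trans d1 | apply: le_trans d2]; apply: ler_wpM2l; rewrite ?ler_norm.
move: pe m1_le m2_le r_le X_le; rewrite /X E1; clear -n0; lia.
Qed.

Lemma vertex_class (T : finType) (G : ograph T) (c : T -> 'I_3) (k : nat) (v : T) :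
  minimizes_ti G -> (100 * 1000 <= k)%N -> (9 * k <= #|T|)%N ->
  k%:Z * offs G c <= #|T|%:Z ^+ 2 ->
  (forall i, k%:Z * `|3 * csize c i - #|T|%:Z| <= #|T|%:Z) ->
  exists i, 60 * off G c v i <= #|T|%:Z.
Proof.
move=> Gmin k_ge Tk Hoffs Hsize.
pose p := cnt G c v (pred1 (Some true)); pose q := cnt G c v (pred1 (Some false)).
have p_ge i : 0 <= p i by apply: cnt_ge0.
have q_ge i : 0 <= q i by apply: cnt_ge0.
have Ez i : cnt G c v (pred1 None) i = csize c i - p i - q i.
  by rewrite -(cnt_sum G c v i) -/(p i) -/(q i); ring.
have pq i : p i + q i <= csize c i.
  by have := cnt_ge0 G c v (pred1 None) i; rewrite Ez -addrA -opprD subr_ge0.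
have ord_eq : [/\ ordS cls0 = cls1, ordS cls1 = cls2 & ordS cls2 = cls0].
  by split; apply: val_inj.
have [O0 O1 O2] := ord_eq.
have T3 : (3 <= #|T|)%N by lia.
have up := bad_at_min c v cls0 Gmin T3; have := bad_at_lower G c v.
rewrite big_ord3 O0 O1 O2 !Ez -/p -/q => low.
have k1 : 1 <= k%:Z by lia.
have k5 : 100 * 1000 <= k%:Z by lia.
have nk : 9 * k%:Z <= #|T|%:Z by lia.
have n0 : 0 < #|T|%:Z by lia.
have gap := cluster_gap (p_ge cls0) (p_ge cls1) (p_ge cls2) (q_ge cls0) (q_ge cls1) (q_ge cls2)
  (pq cls0) (pq cls1) (pq cls2) k1 nk Hoffs (Hsize cls0) (Hsize cls1) (Hsize cls2).
have {}gap := gap ltac:(move: low up; clear; lia).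
have size i : 1000 * `|3 * csize c i - #|T|%:Z| <= #|T|%:Z.
  by apply: le_trans (Hsize i); apply: ler_wpM2r (le_trans _ k5).
have offE i : off G c v i = p i + q i + (csize c (ordS i) - p (ordS i))
   + (csize c (ordS (ordS i)) - q (ordS (ordS i))) by rewrite off_cnt.
clear low up; set e0 := p cls0 + q cls1; set e1 := p cls1 + q cls2; set e2 := p cls2 + q cls0.
have gap1 := gap; rewrite -/e0 -/e1 -/e2 in gap1.
(* The largest of e1, e2, e0 selects class 0, 1 or 2 respectively; the last two cases are rotations
   of the first. *)
have [|] : (e0 <= e1) && (e2 <= e1) \/ (e0 <= e2) && (e1 <= e2) \/ (e1 <= e0) && (e2 <= e0).
- by clear; lia.
- case/andP=> le1 le2; exists cls0; rewrite offE O0 O1.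
  exact: (cluster_pick (p_ge cls0) (p_ge cls1) (p_ge cls2) (q_ge cls0) (q_ge cls1) (q_ge cls2) k5).
case=> /andP[le1 le2].
- exists cls1; rewrite offE O1 O2.
  apply: (cluster_pick (p_ge cls1) (p_ge cls2) (p_ge cls0)
    (q_ge cls1) (q_ge cls2) (q_ge cls0) k5) => //.
  apply: le_trans gap1; rewrite le_eqVlt; apply/orP; left; apply/eqP.
  by rewrite -/e0 -/e1 -/e2; ring.
exists cls2; rewrite offE O2 O0.
apply: (cluster_pick (p_ge cls2) (p_ge cls0) (p_ge cls1)
  (q_ge cls2) (q_ge cls0) (q_ge cls1) k5) => //.
apply: le_trans gap1; rewrite le_eqVlt; apply/orP; left; apply/eqP.
by rewrite -/e0 -/e1 -/e2; ring.
Qed.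

(** Every vertex is put into the class supplied by [vertex_class]. Few vertices move, so the class
    sizes and deviations change little, and the bounds with 60 and [k] weaken to 50. *)
Lemma near_blow : exists n0 : nat, forall (T : finType) (G : ograph T),
  minimizes_ti G -> (n0 < #|T|)%N ->
  exists c : T -> 'I_3, (forall v, 50 * off G c v (c v) <= #|T|%:Z)
    /\ forall i, 50 * `|3 * csize c i - #|T|%:Z| <= #|T|%:Z.
Proof.
have [k Ek] : exists k, k = (100 * 1000)%N by eexists.
have [n1 close] := close_to_blow k; exists (n1 + 9 * k)%N => T G Gmin Tn.
have [|c [Hoffs Hsize]] := close T G Gmin; first by lia.
have vc v : exists i, 60 * off G c v i <= #|T|%:Z.
  by apply: (@vertex_class _ _ _ k) => //; lia.
pose c' v := xchoose (vc v); have c'P v : 60 * off G c v (c' v) <= #|T|%:Z := xchooseP (vc v).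
pose X : int := \sum_v (c' v != c v)%:Z.
have n0 : 0 < #|T|%:Z by lia.
(* The models of two distinct classes differ towards every class, so each link at [v] deviates from
   at least one of them. *)
have two v : c' v != c v -> #|T|%:Z <= off G c v (c' v) + off G c v (c v).
  move=> ne; rewrite -[#|T|%:Z]natz -sumr_const -big_split; apply: ler_sum => y _.
  move: ne; move: (state G v y) (c y) (c' v) (c v).
  by case=> [[]|]; apply: forall_ord3; apply: forall_ord3; apply: forall_ord3.
have XT : 59 * (#|T|%:Z * X) <= 60 * offs G c.
  rewrite /X /offs !mulr_sumr; apply: ler_sum => v _.
  have := c'P v; have := two v; case: (c' v != c v) => [/(_ isT)|_ _].
    by rewrite mulr1; clear; lia.
  by rewrite !mulr0 mulr_ge0 // sumr_ge0.
have X_ge : 0 <= X by apply: sumr_ge0.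
have X_le : 5000 * X <= #|T|%:Z.
  have : #|T|%:Z * (5000 * X) <= #|T|%:Z * #|T|%:Z.
    have E : k%:Z = 100 * 1000 by rewrite Ek.
    move: XT Hoffs; rewrite E expr2 [#|T|%:Z * (_ * _)]mulrCA.
    have : 0 <= #|T|%:Z * X by rewrite mulr_ge0.
    by move: (#|T|%:Z * X) (offs G c) (#|T|%:Z * #|T|%:Z); clear; lia.
  by rewrite ler_pM2l.
have B (a b : bool) : a%:Z <= b%:Z + 1 by case: a; case: b.
exists c'; split=> [v|i].
  have : off G c' v (c' v) <= off G c v (c' v) + X.
    rewrite /off /X -big_split; apply: ler_sum => y _.
    by case: (eqVneq (c' y) (c y)) => [->|_]; [rewrite lerDl | apply: B].
  by have := c'P v; move: X_le n0; clear; lia.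
have h1 : csize c' i <= csize c i + X.
  rewrite /csize /X -big_split; apply: ler_sum => y _.
  by case: (eqVneq (c' y) (c y)) => [->|_]; [rewrite lerDl | apply: B].
have h2 : csize c i <= csize c' i + X.
  rewrite /csize /X -big_split; apply: ler_sum => y _.
  by case: (eqVneq (c' y) (c y)) => [->|_]; [rewrite lerDl | apply: B].
have : 1000 * `|3 * csize c i - #|T|%:Z| <= #|T|%:Z.
  by apply: le_trans (Hsize i); rewrite ler_wpM2r // Ek.
by move: h1 h2 X_le n0; clear; lia.
Qed.

(** * Exactness *)

Section Exact.
Variables (T : finType) (G : ograph T) (c : T -> 'I_3).
Hypothesis Gmin : minimizes_ti G.
Hypothesis T3 : (3 <= #|T|)%N.

Let s := state G.
Let miss (x y : T) : int := (s x y != model (c x) (c y))%:Z.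
Let same (x y : T) : int := (c x == c y)%:Z.

(* [gain x y z] is a lower bound for what the wrong pair xy adds to the number
   of bad triples through the third vertex z, compared with the blow-up. *)
Let gain (x y z : T) : int :=
  (wrong (c x) (c y) (s x y))%:Z
  * (1 - same x z - same y z - miss x z - miss y z).

(** If z lies outside the classes of x and y and is linked to both as in the blow-up, a wrong arc xy
    makes the triangle transitive. The [same] terms pay for the independent triples inside a class
    that such an arc destroys. *)
Lemma gain_bound x y z :
  gain x y z + gain x z y + gain y z x
  <= (uniq [:: x; y; z] && bad3 G x y z)%:Z
     - (uniq [:: x; y; z] && bad3 (blow c) x y z)%:Z.
Proof.
rewrite bad3_blow /gain /same /miss /bad3 -/s.
rewrite /s ![state G z y](state_flip G y z) ![state G z x](state_flip G x z).
rewrite ![state G y x](state_flip G x y).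
case: (boolP (uniq _)) => [_|].
  rewrite !andTb.
  move: (state G x y); apply: forall_linkP; move: (state G x z); apply: forall_linkP.
  move: (state G y z); apply: forall_linkP; move: (c x); apply: forall_classP.
  move: (c y); apply: forall_classP; move: (c z); apply: forall_classP.
  by vm_compute.
rewrite !andFb /= !inE andbT negb_and !negbK -orbA => /or3P[] /eqP <-; rewrite state_refl.
- move: (state G x z); apply: forall_linkP; move: (c x); apply: forall_classP.
  move: (c z); apply: forall_classP.
  by vm_compute.
- rewrite (state_flip G x y).
  move: (state G x y); apply: forall_linkP; move: (c x); apply: forall_classP.
  move: (c y); apply: forall_classP.
  by vm_compute.
move: (state G x y); apply: forall_linkP; move: (c x); apply: forall_classP.
move: (c y); apply: forall_classP.
by vm_compute.
Qed.

(** Summed over z, a wrong pair gains at least n minus two class sizes minus the deviations of its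
    ends, which is positive as two classes hold about 2n / 3 vertices. By minimality against
    [blow c] the total gain is not positive. *)
Lemma no_wrong :
  (forall v, 50 * off G c v (c v) <= #|T|%:Z) ->
  (forall i, 50 * `|3 * csize c i - #|T|%:Z| <= #|T|%:Z) ->
  forall x y, ~~ wrong (c x) (c y) (s x y).
Proof.
move=> Hoff Hsize.
have T_gt0 : 0 < #|T|%:Z by lia.
pose h x y := (wrong (c x) (c y) (s x y))%:Z
  * (#|T|%:Z - csize c (c x) - csize c (c y) - off G c x (c x) - off G c y (c y)).
have sum_gain x y : \sum_z gain x y z = h x y.
  rewrite /gain -mulr_sumr !sumrB sumr_const natz.
  congr (_ * (_ - _ - _ - _ - _)); apply: eq_bigr => z _; by rewrite /same eq_sym.
have S123 : \sum_x \sum_y \sum_z gain x y z = \sum_x \sum_y h x y.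
  by do 2!apply: eq_bigr => ? _.
have S132 : \sum_x \sum_y \sum_z gain x z y = \sum_x \sum_y h x y.
  by rewrite -S123; apply: eq_bigr => x _; rewrite exchange_big.
have S231 : \sum_x \sum_y \sum_z gain y z x = \sum_x \sum_y h x y.
  by rewrite -S132 exchange_big; apply: eq_bigr => x _.
have le : 3 * \sum_x \sum_y h x y <= 0.
  have := min_badset (blow c) Gmin T3 erefl; rewrite -subr_le0; apply: le_trans.
  rewrite (_ : 3 * _ = \sum_x \sum_y \sum_z (gain x y z + gain x z y + gain y z x)).
    rewrite -sumrB; apply: ler_sum => x _; rewrite -sumrB; apply: ler_sum => y _.
    by rewrite -sumrB; apply: ler_sum => z _; apply: gain_bound.
  transitivity (\sum_x \sum_y \sum_z gain x y z + \sum_x \sum_y \sum_z gain x z y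
    + \sum_x \sum_y \sum_z gain y z x); first by rewrite S123 S132 S231; ring.
  by do 3![rewrite -!big_split; apply: eq_bigr => ? _].
have h_pos x y : 0 < #|T|%:Z - csize c (c x) - csize c (c y) - off G c x (c x) - off G c y (c y).
  have := Hoff x; have := Hoff y; have := Hsize (c x); have := Hsize (c y).
  move: T_gt0 (csize c (c x)) (csize c (c y)) (off G c x (c x)) (off G c y (c y)).
  by clear; lia.
have h_ge x y : 0 <= h x y by rewrite mulr_ge0 // ltW.
move=> x y; apply/negP => W.
have hxy : 0 < h x y by rewrite /h W mul1r.
have : h x y <= \sum_x \sum_y h x y.
  rewrite (bigD1 x) //= (bigD1 y) //= -addrA lerDl addr_ge0 //; first exact: sumr_ge0.
  by apply: sumr_ge0 => ? _; apply: sumr_ge0.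
by move: hxy le; clear; lia.
Qed.

(** Triples inside a class are independent once no arc is wrong, which gives one inclusion;
    minimality gives the inequality of cardinalities that turns it into equality. *)
Lemma badset_blow : (forall x y, ~~ wrong (c x) (c y) (s x y)) ->
  badset G = badset (blow c).
Proof.
move=> Hw; apply/esym/eqP; rewrite eqEcard; apply/andP; split; last first.
  by have := min_badset (blow c) Gmin T3 erefl; rewrite !bad6E; lia.
apply/subsetP=> A; rewrite !inE => /andP[A3 H]; rewrite A3 /=.
apply/orP; right; apply/forallP=> x; apply/implyP=> xA; apply/forallP=> y; apply/implyP=> yA.
have cxy : c x = c y.
  have [->//|xy] := eqVneq x y.
  have [z zA zxy] : exists2 z, z \in A & z \notin [set x; y].
    have := subset_leq_card (_ : A \subset [set x; y]); rewrite (eqP A3) cards2 xy.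
    case: (boolP (A \subset [set x; y])) => [_ /(_ isT)//|/subsetPn[z zA zN] _].
    by exists z.
  have U : uniq [:: x; y; z].
    by move: zxy; rewrite /= !inE !negb_or xy ![z == _]eq_sym andbT.
  have EA : A = [set x; y; z].
    apply/esym/eqP; rewrite eqEcard (eqP A3); apply/andP; split.
      by apply/subsetP=> w; rewrite !inE => /orP[/orP[]|] /eqP ->.
    rewrite setUC cardsU1 zxy cards2 xy //.
  have := badsetE (blow c) U; rewrite -EA inE A3 H bad3_blow => /esym/andP[/eqP//].
have := Hw x y; rewrite /s /state /wrong /model cxy eqxx.
by case: (G x y); case: (G y x).
Qed.

Lemma bad3_same : (forall x y, ~~ wrong (c x) (c y) (s x y)) ->
  forall x y z, uniq [:: x; y; z] -> bad3 G x y z = (c x == c y) && (c y == c z).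
Proof.
by move=> /badset_blow E x y z U; rewrite -badsetE // E badsetE // bad3_blow.
Qed.

End Exact.

(** * Balance of the classes *)

Lemma bad_at_blow (T : finType) (c : T -> 'I_3) v :
  bad_at v (blow c) = (csize c (c v) - 1) * (csize c (c v) - 2).
Proof.
pose a y := ((y != v) && (c y == c v))%:Z.
have suma : \sum_y a y = csize c (c v) - 1.
  rewrite /csize (bigD1 v) //= /a eqxx add0r [in RHS](bigD1 v) //= eqxx [RHS]addrAC subrr add0r.
  by apply: eq_bigr => y ->.
have aa y : a y * a y = a y by rewrite /a; case: (_ && _).
transitivity (\sum_y \sum_z (a y * a z - (y == z)%:Z * (a y * a z))).
  apply: eq_bigr => y _; apply: eq_bigr => z _; rewrite bad3_blow /= !inE negb_or andbT /a.
  rewrite ![v == _]eq_sym [c v == c y]eq_sym; case: (eqVneq (c y) (c v)) => [->|_].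
    rewrite [c v == c z]eq_sym.
    by case: (y != v); case: (z != v); case: (y == z); case: (c z == c v).
  by rewrite !andbF /= !mul0r !mulr0 subrr.
have inner y : \sum_z (y == z)%:Z * (a y * a z) = a y.
  rewrite (bigD1 y) //= eqxx mul1r aa big1 ?addr0 // => z.
  by rewrite eq_sym => /negbTE ->; rewrite mul0r.
under eq_bigr do rewrite sumrB inner -mulr_sumr suma.
by rewrite sumrB -mulr_suml suma; ring.
Qed.

(** With class sizes a and b, where a > b + 1, moving a vertex from the first class to the second
    replaces (a - 1)(a - 2) by b (b - 1). This is strictly smaller because a > 2. *)
Lemma csize_balanced (T : finType) (G : ograph T) (c : T -> 'I_3) :
  minimizes_ti G -> (3 <= #|T|)%N -> (forall i, 3 <= csize c i) ->
  badset G = badset (blow c) -> forall i j, csize c i <= csize c j + 1.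
Proof.
move=> Gmin T3 big EG i j; rewrite leNgt; apply/negP => lt.
have [v /eqP cv] : exists v, c v == i.
  apply/existsP; apply: contraTT (big i) => /existsPn no.
  by rewrite /csize big1 // => v _; rewrite (negbTE (no v)).
pose c' x := if x == v then j else c x.
have ij : i != j by apply: contraTneq lt => ->; rewrite -leNgt lerDl.
have Ec' : csize c' j = csize c j + 1.
  rewrite /csize (bigD1 v) //= [in RHS](bigD1 v) //= {1}/c' eqxx cv eqxx (negbTE ij) add0r addrC.
  by congr (_ + _); apply: eq_bigr => x /negbTE xv; rewrite /c' xv.
have := min_badset (blow c') Gmin T3 erefl; rewrite !bad6E EG -!bad6E -subr_ge0.
rewrite (@bad6_local _ (blow c) v) => [|x y /negbTE xv /negbTE yv]; last first.
  by rewrite !state_blow /c' xv yv.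
have c'v : c' v = j by rewrite /c' eqxx.
rewrite !bad_at_blow cv c'v Ec' pmulr_rge0 // subr_ge0 leNgt => /negP[].
have mj := csize_ge0 c j.
rewrite (_ : csize c j + 1 - 1 = csize c j); last by ring.
have h1 : csize c j * (csize c j + 1 - 2) <= csize c j * (csize c i - 2).
  by rewrite ler_wpM2l //; move: lt; clear; lia.
apply: le_lt_trans h1 _; rewrite ltr_pM2r; move: lt (big i); clear; lia.
Qed.

(** Three sizes differing pairwise by at most one become nondecreasing, like the part sizes of
    [vertex], after a rotation of the classes, and rotations preserve [model]. *)
Lemma rotate_classes (T : finType) (c : T -> 'I_3) :
  (forall i j, csize c i <= csize c j + 1) ->
  exists r : 'I_3 -> 'I_3, (forall i j, model (r i) (r j) = model i j)
    /\ forall i, csize (fun x => r (c x)) i = ((#|T| + i) %/ 3)%N%:Z.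
Proof.
move=> bal; have [O0 O1 O2] : [/\ ordS cls0 = cls1, ordS cls1 = cls2 & ordS cls2 = cls0].
  by split; apply: val_inj.
have rot1 i j : model (ordS i) (ordS j) = model i j.
  by move: i j; apply: forall_ord3; apply: forall_ord3; rewrite ?O0 ?O1 ?O2.
have size1 d i : csize (fun x : T => ordS (d x)) (ordS i) = csize d i.
  by apply: eq_bigr => x _; rewrite (inj_eq (@ordS_inj 3)).
have := sum_csize c; rewrite big_ord3 => Hn.
have [b01 [b02 b12]] : `|csize c cls0 - csize c cls1| <= 1 /\
   `|csize c cls0 - csize c cls2| <= 1 /\ `|csize c cls1 - csize c cls2| <= 1.
  have := bal cls0 cls1; have := bal cls1 cls0; have := bal cls0 cls2.
  have := bal cls2 cls0; have := bal cls1 cls2; have := bal cls2 cls1.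
  by clear; lia.
have [m0 [m1 m2]] := (csize_ge0 c cls0, (csize_ge0 c cls1, csize_ge0 c cls2)).
have [h|[h|h]] :
  (csize c cls0 <= csize c cls1 /\ csize c cls1 <= csize c cls2) \/
  (csize c cls1 <= csize c cls2 /\ csize c cls2 <= csize c cls0) \/
  (csize c cls2 <= csize c cls0 /\ csize c cls0 <= csize c cls1).
- by move: b01 b02 b12; clear; lia.
- exists id; split=> // i; rewrite -[csize _ i]/(csize c i); move: i.
  apply: forall_ord3; move: Hn b01 b02 b12 h m0 m1 m2; clear; rewrite /=; lia.
- exists (fun i => ordS (ordS i)); split=> [i j|]; first by rewrite !rot1.
  apply: forall_ord3.
  + rewrite -{1}O2 -{1}O1 !size1; move: Hn b01 b02 b12 h m0 m1 m2; clear; rewrite /=; lia.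
  + rewrite -{1}O0 -{1}O2 !size1; move: Hn b01 b02 b12 h m0 m1 m2; clear; rewrite /=; lia.
  rewrite -{1}O1 -{1}O0 !size1; move: Hn b01 b02 b12 h m0 m1 m2; clear; rewrite /=; lia.
exists (fun i => ordS i); split=> [i j|]; first by rewrite !rot1.
apply: forall_ord3.
+ rewrite -{1}O2 !size1; move: Hn b01 b02 b12 h m0 m1 m2; clear; rewrite /=; lia.
+ rewrite -{1}O0 !size1; move: Hn b01 b02 b12 h m0 m1 m2; clear; rewrite /=; lia.
rewrite -{1}O1 !size1; move: Hn b01 b02 b12 h m0 m1 m2; clear; rewrite /=; lia.
Qed.

Lemma class_bijection (T : finType) (c : T -> 'I_3) (n : nat) :
  #|T| = n -> (forall i, csize c i = ((n + i) %/ 3)%N%:Z) ->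
  exists2 f : T -> vertex n, bijective f & forall x, tag (f x) = c x.
Proof.
move=> Tn size.
have EA i : #|[set x | c x == i]| = ((n + i) %/ 3)%N.
  apply/eqP; rewrite -eqz_nat -size /csize -sum1_card -natz natr_sum big_mkcond.
  by apply/eqP; apply: eq_bigr => x _; rewrite inE; case: eqP.
have xA x : x \in [set y | c y == c x] by rewrite inE.
pose f x : vertex n :=
  existT (fun i : 'I_3 => 'I_((n + i) %/ 3)) (c x)
    (cast_ord (EA (c x)) (enum_rank_in (xA x) x)).
pose g (v : vertex n) : T := enum_val (cast_ord (esym (EA (tag v))) (tagged v)).
have fK : cancel f g by move=> x; rewrite /g /f /= cast_ordK enum_rankK_in.
exists f => //; apply: inj_card_bij; first exact: can_inj fK.
by rewrite card_vertex Tn.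
Qed.

(** * The missing arcs as a union of three matchings *)

Section Deletion.
Variables (n : nat) (T : finType) (G : ograph T) (f : T -> vertex n) (g : vertex n -> T).
Hypotheses (fK : cancel f g) (gK : cancel g f).
Hypothesis no_wrong_f :
  forall x y, ~~ wrong (tag (f x)) (tag (f y)) (state G x y).
Hypothesis bad3_f : forall x y z, uniq [:: x; y; z] ->
  bad3 G x y z = (tag (f x) == tag (f y)) && (tag (f y) == tag (f z)).

Definition hole_arc (u v : vertex n) : bool := B_arc u v && ~~ G (g u) (g v).

Lemma hole_irrefl : irreflexive hole_arc.
Proof. by move=> u; rewrite /hole_arc B_arc_irrefl. Qed.

Lemma hole_antisym u v : hole_arc u v -> ~~ hole_arc v u.
Proof. by case/andP=> /B_arc_antisym /negbTE vu _; rewrite /hole_arc vu. Qed.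

Definition hole : ograph (vertex n) := OGraph hole_irrefl hole_antisym.

Lemma arc_class x y : G x y -> tag (f y) = ordS (tag (f x)).
Proof.
move=> Gxy; have := no_wrong_f x y; rewrite /state Gxy.
suff -> : forall i j, ~~ wrong i j (Some true) = (j == ordS i) by move/eqP.
by apply: forall_ord3; apply: forall_ord3.
Qed.

Lemma hole_class u v : hole u v -> tag v = ordS (tag u).
Proof. by case/andP=> /eqP. Qed.

Lemma ordS_neq (i : 'I_3) : ordS i != i.
Proof. by move: i; apply: forall_ord3. Qed.

Lemma hole_state u v : hole u v -> state G (g u) (g v) = None.
Proof.
move=> uv; have E := hole_class uv; case/andP: uv => _ /negbTE nG.
rewrite /state nG; case Gvu: (G (g v) (g u)) => //.
have := arc_class Gvu; rewrite !gK E => /eqP.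
by move: (tag u); apply: forall_ord3.
Qed.

Lemma adjacent_hole_state u v : adjacent hole u v -> state G (g u) (g v) = None.
Proof. by case/orP=> /hole_state //; rewrite state_flip; case: (state G (g u) (g v)). Qed.

Lemma adjacent_hole_class u v : adjacent hole u v -> tag u != tag v.
Proof.
by case/orP=> /hole_class ->; rewrite ?ordS_neq // eq_sym ordS_neq.
Qed.

Lemma same_class_state u v : tag u = tag v -> state G (g u) (g v) = None.
Proof.
move=> E; have := no_wrong_f (g u) (g v); rewrite !gK E /wrong /model eqxx.
by case: (state _ _ _) => [[]|].
Qed.

Lemma nonadj_class u v w : uniq [:: u; v; w] ->
  state G (g u) (g v) = None -> state G (g u) (g w) = None ->
  state G (g v) (g w) = None -> (tag u = tag v) * (tag v = tag w).
Proof.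
move=> U uv uw vw; have := bad3_f (x := g u) (y := g v) (z := g w).
rewrite -[[:: g u; g v; g w]]/(map g [:: u; v; w]) map_inj_uniq; last exact: can_inj gK.
by move=> /(_ U); rewrite /bad3 uv uw vw !gK /= => /esym/andP[/eqP -> /eqP ->].
Qed.

(** A triangle of holes, or two holes between the same two classes sharing an endpoint, would yield
    an independent triple not contained in one class, against [bad3_f]. *)
Lemma hole_in_M : in_M hole.
Proof.
split=> [u v w|].
  apply/negP=> /and3P[uv vw uw].
  have [Cuv Cvw Cuw] := And3 (adjacent_hole_class uv) (adjacent_hole_class vw)
    (adjacent_hole_class uw).
  have ne a b : tag a != tag b :> 'I_3 -> a != b :> vertex n by apply: contraNneq => ->.
  have U : uniq [:: u; v; w] by rewrite /= !inE negb_or !ne.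
  have [E _] := nonadj_class U (adjacent_hole_state uv) (adjacent_hole_state uw)
    (adjacent_hole_state vw).
  by rewrite E eqxx in Cuv.
exists (fun i u v => hole u v && (tag u == i)); split=> [i|u v]; last first.
  apply/idP/existsP=> [uv|[i /andP[]//]]; by exists (tag u); rewrite uv eqxx.
split=> [u v /andP[uv /eqP ui]|u v u' v' /andP[uv /eqP ui] /andP[uv' /eqP ui'] ne].
  by rewrite !inE (hole_class uv) ui !eqxx.
have [vi vi'] := (hole_class uv, hole_class uv'); rewrite ui in vi; rewrite ui' in vi'.
have cross a b : tag a = i -> tag b = ordS i -> a != b :> vertex n.
  by move=> ai bi; apply: contraTneq (ordS_neq i) => ab; rewrite -bi -ab ai eqxx.
have uu' : u != u'.
  apply/eqP=> E; rewrite -E in uv' ne.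
  have vv' : v != v' by apply: contraNneq ne => ->.
  have U : uniq [:: u; v; v'] by rewrite /= !inE negb_or (cross u v) // (cross u v') // vv'.
  have [] := nonadj_class U (hole_state uv) (hole_state uv') (same_class_state _).
    by rewrite vi vi'.
  by move=> /eqP; rewrite ui vi eq_sym (negbTE (ordS_neq i)).
have vv' : v != v'.
  apply/eqP=> E; rewrite -E in uv' ne.
  have U : uniq [:: u; u'; v] by rewrite /= !inE negb_or (cross u v) // (cross u' v) // uu'.
  have [] := nonadj_class U (same_class_state _) (hole_state uv) (hole_state uv').
    by rewrite ui ui'.
  by move=> _ /eqP; rewrite ui' vi eq_sym (negbTE (ordS_neq i)).
rewrite -setI_eq0; apply/eqP/setP=> w; rewrite !inE; apply/negP=> /andP[].
case/orP=> /eqP ->; case/orP.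
- by rewrite (negbTE uu').
- by rewrite (negbTE (cross _ _ ui vi')).
- by rewrite eq_sym (negbTE (cross _ _ ui' vi)).
by rewrite (negbTE vv').
Qed.

Lemma iso_delete : isomorphic G (delete (B_graph n) hole).
Proof.
exists f; split=> [|x y]; first by exists g.
rewrite /= /del_arc /= /hole_arc !fK; case Gxy: (G x y); last by rewrite andbT; case: B_arc.
by rewrite /B_arc (arc_class Gxy) eqxx.
Qed.

End Deletion.

Theorem theorem1p5 :
  exists n0 : nat, forall n : nat, (n0 < n)%N ->
    forall (T : finType) (G : ograph T),
      #|T| = n -> minimizes_ti G -> in_E n G.
Proof.
have [n0 near] := near_blow; exists (n0 + 20)%N => n nn0 T G Tn Gmin.
have T3 : (3 <= #|T|)%N by lia.
have [|c [Hoff Hsize]] := near T G Gmin; first by lia.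
have nw := no_wrong Gmin T3 Hoff Hsize.
have bal := csize_balanced Gmin T3 _ (badset_blow Gmin T3 nw).
have {}bal : forall i j, csize c i <= csize c j + 1.
  apply: bal => i; have := Hsize i; have : 20 <= #|T|%:Z by lia.
  by move: (csize c i); clear; lia.
have [r [rmodel rsize]] := rotate_classes bal; rewrite Tn in rsize.
have [f fbij ftag] := class_bijection Tn rsize; have [g fK gK] := fbij.
have r_inj i j : (r i == r j) = (i == j).
  have := rmodel i j; rewrite /model; by case: (r i == r j); case: (i == j).
have nwf x y : ~~ wrong (tag (f x)) (tag (f y)) (state G x y).
  by rewrite /wrong !ftag rmodel; apply: nw.
have b3f x y z : uniq [:: x; y; z] ->
    bad3 G x y z = (tag (f x) == tag (f y)) && (tag (f y) == tag (f z)).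
  by move=> U; rewrite !ftag !r_inj; apply: bad3_same.
exists (hole G g); split; first exact: hole_in_M gK nwf b3f.
exact: iso_delete fK gK nwf.
Qed.
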